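(* Let $p$ be a prime, let $q$ be an odd prime that divides $p-1$, and let $n>q$ be an integer. Then there exists a finite solvable group $G$ with $\mathrm{dl}(G)=4$, Fitting height $3$, and $$\mathrm{cd}(G)=\{1,\ q,\ (p^q-1)_{q'}(p-1)_q\,q,\ p^n q\}.$$
   Context: $\mathrm{cd}(G)$ is the set of degrees of irreducible complex characters of $G$, and $\mathrm{dl}(G)$ is the derived length of $G$. For a positive integer $N$ and a prime $q$, $N_q$ denotes the largest power of $q$ dividing $N$, and $N_{q'}=N/N_q$. *)

(* Defs.v *)
From HB Require Import structures.
From mathcomp Require Import all_boot all_order all_algebra all_fingroup all_solvable all_field all_character.
Set Implicit Arguments. Unset Strict Implicit. Unset Printing Implicit Defensive.
Import GRing.Theory Num.Theory.

Local Open Scope ring_scope.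

(* cd(G): the list of degrees chi(1) of the irreducible complex characters of G
   (as elements of algC; membership in this list is the set cd(G)). *)
Definition cd (gT : finGroupType) (G : {group gT}) : seq algC :=
  [seq 'chi[G]_i 1%g | i : Iirr G].

(* dl(G) = n : n is the least integer with G^(n) = 1 (derived series is
   decreasing, so it suffices that G^(n) = 1 and G^(n-1) <> 1 when n > 0). *)
Definition derived_length_eq (gT : finGroupType) (G : {set gT}) (n : nat) : bool :=
  (G^`(n) == 1)%g && ((n == 0%N) || (G^`(n.-1) != 1)%g).

Fixpoint upper_fitting (gT : finGroupType) (G : {set gT}) (i : nat) : {set gT} :=
  if i is m.+1 then
    (coset (upper_fitting G m) @*^-1 'F(G / upper_fitting G m))%g
  else 1%g.

Definition fitting_height_eq (gT : finGroupType) (G : {set gT}) (h : nat) : bool :=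
  (upper_fitting G h == G) && ((h == 0%N) || (upper_fitting G h.-1 != G)).

(* Main.v *)
(* Since q is odd and divides p - 1, the q-part of p^q - 1 is q (p - 1)_q, so the third
   degree is p^q - 1 and the degrees to realize are 1, q, p^q - 1 and p^n q.

   Let w generate the multiplicative group of F = F_(p^q). The maps
   v |-> w^k v^(p^k), with k modulo p^q - 1, form a group D (the multiplicative group of a
   Dickson near-field) that acts regularly on F \ {0}; the maps with q | k form an abelian
   normal subgroup C of index q. Put X = Y = F + W with W = (F_p)^(n - q), pair X with Y into
   Z = F_p by the trace form on F and the dot product on W, and let D act on X, Y and Z,
   compatibly with the pairing, so that C centralizes both copies of W as well as Z, D acts
   regularly on the nonzero vectors of both copies of F, and D / C acts on Z by a character of
   order q. Let P be the Heisenberg group on X x Y x Z and G = P D.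

   A character of G that is trivial on Z and on both copies of F is a character of a group
   with an abelian normal subgroup of index q: its degree is 1 or q. If it is trivial on Z
   only, then it lies over a linear character of P with inertia group P: its degree is |D|.
   Otherwise it lies over a character of P of degree p^n vanishing off Z, whose inertia group
   is contained in P C, so that its degree is at least p^n q; it also has a nonzero vector
   fixed by Y, hence a linear constituent on Y Z C, which has index p^n q. *)
Require Import Defs.
From HB Require Import structures.
From mathcomp Require Import all_boot all_order all_algebra all_fingroup all_solvable all_field all_character.
From mathcomp Require Import zify.

Set Implicit Arguments. Unset Strict Implicit. Unset Printing Implicit Defensive.
Import GroupScope Order.TTheory GRing.Theory Num.Theory.
Local Open Scope ring_scope.

(** * Character degrees from a normal series *)

(** By Clifford, the restriction to H is a positive multiple of the sum of the G-conjugates of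
    ['chi_j], and their number is the index of the inertia group. *)
Lemma irr1_ge_inertia_index (gT : finGroupType) (G H : {group gT}) i j :
    H <| G -> j \in irr_constt ('Res[H] 'chi[G]_i) ->
  #|G : 'I_G['chi_j]|%:R * 'chi_j 1%g <= 'chi_i 1%g.
Proof.
move=> nsHG rij; have [sHG _] := andP nsHG.
rewrite -(cfRes1 H 'chi_i) (Clifford_Res_sum_cfclass nsHG rij) cfunE sum_cfunE.
have -> : \sum_(chi <- ('chi_j ^: G)%CF) chi 1%g
          = #|G : 'I_G['chi_j]|%:R * 'chi_j 1%g.
  rewrite -size_cfclass mulr_natl (eq_big_seq (fun=> 'chi_j 1%g)).
    by rewrite big_const_seq count_predT iter_addr_0.
  by move=> _ /cfclassP[y _ ->]; rewrite cfConjg1.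
have /natrP[e De] : '['Res[H] 'chi_i, 'chi_j] \in Num.nat.
  by rewrite Cnat_cfdot_char ?cfRes_char ?irr_char.
rewrite De ler_peMl ?mulr_ge0 ?ler0n ?char1_ge0 ?irr_char //.
by move: rij; rewrite irr_consttE De pnatr_eq0 -lt0n ler1n.
Qed.

Lemma irr1_le_index (gT : finGroupType) (G H : {group gT}) i j :
    H \subset G -> j \in irr_constt ('Res[H] 'chi[G]_i) ->
  'chi_i 1%g <= #|G : H|%:R * 'chi_j 1%g.
Proof.
move=> sHG rij; rewrite -cfInd1 // char1_ge_constt ?cfInd_char ?irr_char //.
by rewrite constt_Ind_Res.
Qed.

(** A normal subgroup is the intersection of the kernels of the irreducible characters containing
    it. *)
Lemma exists_irr_separating (gT : finGroupType) (G H K : {group gT}) :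
    H <| G -> ~~ (K \subset H) ->
  exists2 i, H \subset cfker 'chi[G]_i & ~~ (K \subset cfker 'chi[G]_i).
Proof.
move=> nsHG not_sKH.
have [i /andP[] | no_i] := pickP [pred i |
  (H \subset cfker 'chi[G]_i) && ~~ (K \subset cfker 'chi[G]_i)]; first by exists i.
case/negP: not_sKH; rewrite -(cap_cfker_normal nsHG).
by apply/bigcapsP => i Hi; have /= := no_i i; rewrite Hi /= => /negbFE.
Qed.

Lemma inertia_lin_char_ker (gT : finGroupType) (H : {group gT}) (xi : 'CF(H)) g x y :
    xi \is a linear_char -> g \in 'I[xi] -> x \in H -> y \in H ->
  (x ^ g = x * y)%g -> xi y = 1.
Proof.
move=> Lxi Ig Hx Hy /(congr1 xi); rewrite (inertia_valJ _ Ig) lin_charM //.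
move/esym; rewrite -[X in _ = X]mulr1; apply: mulfI; exact: lin_char_neq0.
Qed.

Lemma commg_sub_of_swap (gT : finGroupType) (H K L : {group gT}) :
    (forall x y, x \in H -> y \in K -> exists2 z, z \in L & x * y = y * x * z)%g ->
  [~: H, K] \subset L.
Proof.
move=> com; rewrite gen_subG; apply/subsetP=> _ /imset2P[x y Hx Ky ->].
have [z Lz xyz] := com x y Hx Ky.
by rewrite commgEl conjgE xyz -!mulgA !mulKg.
Qed.

Lemma cfdot_neq0_constt (gT : finGroupType) (G : {group gT}) (phi psi : 'CF(G)) :
  '[phi, psi] != 0 -> exists2 i, i \in irr_constt phi & i \in irr_constt psi.
Proof.
move=> nz; have [i /andP[] | no_i] :=
  pickP [pred i | (i \in irr_constt phi) && (i \in irr_constt psi)]; first by exists i.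
case/eqP: nz; rewrite cfdot_sum_irr big1 // => i _.
have /negbT := no_i i; rewrite /= !irr_consttE negb_and !negbK.
by case/orP=> /eqP->; rewrite ?mul0r ?conjC0 ?mulr0.
Qed.

(** If N lies in the kernel of ['chi_j], the trivial character of N occurs in ['chi_i]; as N is
    normal in G, this puts N in the kernel of ['chi_i]. *)
Lemma sub_cfker_constt_Res (gT : finGroupType) (G H N : {group gT}) i j :
    N <| G -> N \subset H -> H \subset G -> j \in irr_constt ('Res[H] 'chi[G]_i) ->
  (N \subset cfker 'chi_j) = (N \subset cfker 'chi_i).
Proof.
move=> nsNG sNH sHG rij; apply/idP/idP=> [kerN | kerN]; last first.
  apply: subset_trans (cfker_constt (cfRes_char _ (irr_char i)) rij).
  by rewrite cfker_Res ?irr_char // subsetI sNH.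
apply: constt0_Res_cfker => //; rewrite -(cfResRes _ sNH sHG).
apply: (constt_Res_trans (cfRes_char _ (irr_char i)) rij).
have -> : 'Res[N] 'chi_j = 'chi_j 1%g *: 1.
  apply/cfun_inP=> x Nx; rewrite cfResE // cfunE cfun1E Nx mulr1.
  by have := subsetP kerN x Nx; rewrite cfkerEirr inE => /eqP.
by rewrite irr_consttE -irr0 cfdotZl cfnorm_irr mulr1 irr1_neq0.
Qed.

(** * Faithful characters over a centre of prime order *)

Section PrimeCenter.

Variables (gT : finGroupType) (P Z : {group gT}) (p n : nat).
Hypotheses (pr_p : prime p) (oZ : #|Z| = p) (oP : #|P| = (p ^ n.*2.+1)%N).
Hypotheses (defZ : 'Z(P) = Z) (sP'Z : (P^`(1))%g \subset Z).
Variable j : Iirr P.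
Hypothesis kerZ : ~~ (Z \subset cfker 'chi_j).

(** Commutators of P with the centre of ['chi_j] lie both in Z and in the kernel of ['chi_j]. These
    meet trivially, Z being of prime order and not in the kernel. *)
Lemma cfcenter_prime_center : 'Z('chi_j)%CF = Z.
Proof.
have sZP : Z \subset P by rewrite -defZ center_sub.
have tiZK : Z :&: cfker 'chi_j = 1%g.
  by apply: prime_TIg; rewrite ?oZ.
apply/eqP; rewrite eqEsubset; apply/andP; split; last first.
  by rewrite -defZ -cap_cfcenter_irr bigcap_inf.
rewrite -defZ subsetI cfcenter_sub /=; apply/commG1P/trivgP; rewrite -tiZK subsetI.
apply/andP; split; first exact: subset_trans (commSg _ (cfcenter_sub _)) sP'Z.
have nKP := normal_norm (cfker_normal 'chi_j).
rewrite -quotient_cents2 ?(subset_trans (cfcenter_sub _)) //.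
by rewrite cfcenter_eq_center subsetIr.
Qed.

(** P is abelian modulo the centre of ['chi_j], so the bound of ['chi_j 1] squared by the index of
    that centre is attained; equality forces vanishing off the centre. *)
Lemma irr_prime_center_vanish x : x \notin Z -> 'chi_j x = 0.
Proof.
have abP : abelian (P / 'Z('chi_j)%CF)%g.
  by rewrite cfcenter_prime_center sub_der1_abelian.
have := irr1_bound j; rewrite (irr1_abelian_bound abP).
by case=> _; rewrite eqxx cfcenter_prime_center => /esym/cfun_onP; apply.
Qed.

Lemma irr1_prime_center : 'chi_j 1%g = (p ^ n)%:R.
Proof.
have abP : abelian (P / 'Z('chi_j)%CF)%g.
  by rewrite cfcenter_prime_center sub_der1_abelian.
have sZP : Z \subset P by rewrite -defZ center_sub.
apply: (@pexpIrn _ 2) => //; rewrite ?nnegrE ?char1_ge0 ?irr_char ?ler0n //.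
rewrite irr1_abelian_bound // cfcenter_prime_center -divgS // oZ oP expnS.
by rewrite mulKn ?prime_gt0 // -natrX -expnM muln2.
Qed.

End PrimeCenter.

(** * Degrees, derived length and Fitting height from a chain Z < S < P < M < G *)

Section Chain.

Variables (gT : finGroupType) (G M P S Z R U B : {group gT}) (p q n : nat).
Hypotheses (pr_p : prime p) (pr_q : prime q).
Hypotheses (nsZG : Z <| G) (nsSG : S <| G) (nsPG : P <| G) (nsMG : M <| G).
Hypotheses (sZS : Z \subset S) (sSP : S \subset P) (sPM : P \subset M).
Hypotheses (oZ : #|Z| = p) (oP : #|P| = (p ^ n.*2.+1)%N) (iMG : #|G : M| = q).
Hypotheses (cZM : M \subset 'C(Z)) (sP'Z : (P^`(1))%g \subset Z) (sM'S : (M^`(1))%g \subset S).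
Hypotheses (sZPZ : 'Z(P) \subset Z) (not_cSS : ~~ abelian S).
(** Fixed-point freeness in commutator form: z is the commutator of z' and g. [regS] is the analogue
    for S modulo Z. *)
Hypothesis regZ : forall g z, g \in G -> g \notin M -> z \in Z ->
  exists2 z', z' \in Z & (z' ^ g = z' * z)%g.
Hypothesis regS : forall g x, g \in G -> g \notin P -> x \in S ->
  exists2 s, s \in S & exists2 z, z \in Z & (s ^ g = s * (x * z))%g.
Hypotheses (sRG : R \subset G) (not_sRP : ~~ (R \subset P)).
(* R witnesses that G / P is not nilpotent. *)
Hypothesis sR_RG : R \subset [~: R, G] <*> P.
(** [U] and [B] serve the upper bound for degrees over Z: the trivial character of [U] occurs there,
    and yields a linear constituent on [B] because [B] is abelian modulo [U]. *)
Hypotheses (sUB : U \subset B) (sBG : B \subset G) (sUP : U \subset P).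
Hypotheses (sB'U : (B^`(1))%g \subset U) (tiUZ : U :&: Z = 1%g).
Hypothesis iBG : #|G : B| = (p ^ n * q)%N.

Let sZP : Z \subset P := subset_trans sZS sSP.
Let sMG : M \subset G := normal_sub nsMG.
Let sPG : P \subset G := normal_sub nsPG.

Let defZ : 'Z(P) = Z.
Proof.
apply/eqP; rewrite eqEsubset sZPZ subsetI sZP.
by rewrite centsC (subset_trans _ cZM).
Qed.

Lemma irr1_over_center i : ~~ (Z \subset cfker 'chi[G]_i) -> 'chi_i 1%g = (p ^ n * q)%:R.
Proof.
move=> kerZ; have [j rij] := constt_cfRes_irr P i.
have kerZj : ~~ (Z \subset cfker 'chi_j).
  apply: contra kerZ => kerZj.
  by rewrite -(sub_cfker_constt_Res nsZG sZP sPG rij).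
have thZ := irr1_prime_center pr_p oZ oP defZ sP'Z kerZj.
apply/eqP; rewrite eq_le; apply/andP; split; last first.
  apply: le_trans (irr1_ge_inertia_index nsPG rij); rewrite thZ -natrM ler_nat mulnC.
  rewrite leq_mul2r -iMG dvdn_leq ?indexg_gt0 ?orbT //.
  apply: indexgS; apply/subsetP=> g /setIP[Gg Ig].
  apply: contraR (kerZj) => notMg.
  (* On its centre Z, ['chi_j] is a multiple of a linear character [xi]. Invariance under g, applied
     to z' ^ g = z' z, gives xi z = 1 for every z in Z, so Z would lie in the kernel. *)
  have [xi Lxi Dxi] := cfcenter_Res 'chi_j.
  have ZE := cfcenter_prime_center pr_p oZ defZ sP'Z kerZj.
  apply/subsetP=> z Zz; have [z' Zz' Ez'] := regZ Gg notMg Zz.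
  have Dx x : x \in Z -> 'chi_j x = 'chi_j 1%g * xi x.
    rewrite -ZE => Zx; have /cfunP/(_ x) := Dxi.
    by rewrite cfResE ?cfcenter_sub // cfunE.
  have nz := irr1_neq0 j.
  have := inertia_valJ z' Ig; rewrite Ez' (Dx _ (groupM Zz' Zz)) (Dx z') // => /(mulfI nz).
  move: (Zz) (Zz'); rewrite -ZE => Xz Xz'.
  rewrite lin_charM // -[RHS]mulr1 => /(mulfI (lin_char_neq0 Lxi Xz')) xiz.
  by rewrite cfkerEirr inE (Dx z) // xiz mulr1.
have sUG := subset_trans sUP sPG.
(* 'chi_j vanishes off Z and U meets Z trivially, so the restriction of 'chi_j to U is a
   multiple of the regular character. *)
have rU0 : 0 \in irr_constt ('Res[U] 'chi_j).
  rewrite irr_consttE irr0 cfdotE (bigD1 1%g) //= big1 => [|u /andP[Uu u1]].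
    rewrite addr0 cfResE // cfun1E group1 conjC1 mulr1.
    by rewrite mulf_neq0 ?irr1_neq0 // invr_eq0 pnatr_eq0 -lt0n cardG_gt0.
  rewrite cfResE // (irr_prime_center_vanish pr_p oZ defZ sP'Z kerZj) ?mul0r //.
  by apply: contra u1 => Zu; rewrite -in_set1 -[[set 1%g]]tiUZ inE Uu.
(* Some constituent ['chi_k] of ['chi_i] on B lies over the trivial character of U. As U is normal
   in B and contains B', ['chi_k] is linear. *)
have := constt_Res_trans (cfRes_char P (irr_char i)) rij rU0; rewrite cfResRes //.
rewrite -(cfResRes _ sUB sBG) irr_consttE cfdot_Res_l => /cfdot_neq0_constt[k rik].
rewrite constt_Ind_Res => rk0.
have nsUB : U <| B.
  by rewrite /normal sUB sub_der1_norm.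
have Lk : 'chi_k \is a linear_char.
  by rewrite lin_irr_der1 (subset_trans sB'U) // constt0_Res_cfker.
by have := irr1_le_index sBG rik; rewrite (lin_char1 Lk) mulr1 iBG.
Qed.

Lemma irr1_over_frobenius_section i :
    Z \subset cfker 'chi[G]_i -> ~~ (S \subset cfker 'chi_i) ->
  'chi_i 1%g = #|G : P|%:R.
Proof.
move=> kerZ kerS; have [j rij] := constt_cfRes_irr P i.
have kerZj : Z \subset cfker 'chi_j by rewrite (sub_cfker_constt_Res nsZG sZP sPG rij).
have kerSj : ~~ (S \subset cfker 'chi_j).
  by rewrite (sub_cfker_constt_Res nsSG sSP sPG rij).
have Lj : 'chi_j \is a linear_char by rewrite lin_irr_der1 (subset_trans sP'Z).
apply/eqP; rewrite eq_le; apply/andP; split.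
  by have := irr1_le_index sPG rij; rewrite (lin_char1 Lj) mulr1.
have := irr1_ge_inertia_index nsPG rij; rewrite (lin_char1 Lj) mulr1.
apply: le_trans; rewrite ler_nat dvdn_leq ?indexg_gt0 // indexgS //.
apply/subsetP=> g /setIP[Gg Ig]; apply: contraR kerSj => notPg.
(* Invariance under g gives the value 1 at x z, and z is in the kernel, so x is too: the inertia
   group is no larger than P. *)
apply/subsetP=> x Sx; have [s Ss [z Zz Es]] := regS Gg notPg Sx.
have Px := subsetP sSP x Sx; have Pz := subsetP sZP z Zz.
have := inertia_lin_char_ker Lj Ig (subsetP sSP s Ss) (groupM Px Pz) Es.
rewrite lin_charM // cfkerEirr inE (lin_char1 Lj).
have := subsetP kerZj z Zz; rewrite cfkerEirr inE (lin_char1 Lj) => /eqP->.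
by rewrite mulr1 => ->.
Qed.

(** M is abelian modulo S, so the constituents on M are linear; M has prime index q, so there is one
    of them or there are q distinct ones. *)
Lemma irr1_over_abelian_section i :
  S \subset cfker 'chi[G]_i -> 'chi_i 1%g = 1 \/ 'chi_i 1%g = q%:R.
Proof.
move=> kerS; have sSM := subset_trans sSP sPM.
have Lj j : j \in irr_constt ('Res[M] 'chi_i) -> 'chi_j 1%g = 1.
  move=> rij; apply: lin_char1; rewrite lin_irr_der1 (subset_trans sM'S) //.
  by rewrite (sub_cfker_constt_Res nsSG sSM sMG rij).
have [/irrP[j Dj] | [c c_inj Dc]] := cfRes_prime_irr_cases i nsMG iMG pr_q.
  left; rewrite -(cfRes1 M) Dj Lj //.
  by rewrite Dj constt_irr inE.
right; rewrite -(cfRes1 M) Dc sum_cfunE (eq_bigr (fun=> 1)).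
  by rewrite sumr_const card_ord.
move=> k _; apply: Lj.
rewrite irr_consttE Dc cfdot_suml (bigD1 k) //= cfnorm_irr big1 ?addr0 ?oner_eq0 //.
by move=> l lk; rewrite cfdot_irr (inj_eq c_inj) (negPf lk).
Qed.

Let sPRG : ~~ ([~: R, G] \subset P).
Proof.
by apply: contra not_sRP => ?; rewrite (subset_trans sR_RG) // join_subG subxx andbT.
Qed.

Let ntZ : Z != 1%G.
Proof. by rewrite -cardG_gt1 oZ prime_gt1. Qed.

Let not_sSZ : ~~ (S \subset Z).
Proof.
apply: contra not_cSS => /abelianS; apply.
by rewrite cyclic_abelian // prime_cyclic // oZ.
Qed.

Lemma cd_chain :
  cd G =i [seq (d%:R : algC) | d <- [:: 1%N; q; #|G : P|; p ^ n * q]%N].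
Proof.
move=> d; apply/imageP/idP=> [[i _ ->] | ].
  rewrite !inE; have [kerZ | kerZ] := boolP (Z \subset cfker 'chi_i); last first.
    by rewrite irr1_over_center ?eqxx ?orbT.
  have [kerS | kerS] := boolP (S \subset cfker 'chi_i); last first.
    by rewrite irr1_over_frobenius_section ?eqxx ?orbT.
  by have [] := irr1_over_abelian_section kerS => ->; rewrite eqxx ?orbT.
rewrite !inE => /or4P[] /eqP->.
- by exists 0 => //; rewrite irr0 cfun11.
(* Degree q needs a nonlinear character trivial on S: G' is not inside S, since [[~: R, G]] is not
   inside P. *)
- have : ~~ ((G^`(1))%g \subset S).
    apply: contra sPRG => sG'S; apply: subset_trans sSP.
    by apply: subset_trans sG'S; rewrite commSg.
  case/(exists_irr_separating nsSG) => i kerS; rewrite -lin_irr_der1 => nL.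
  exists i => //; have [i1 | ->] := irr1_over_abelian_section kerS => //.
  by case/negP: nL; rewrite qualifE /= irr_char i1 eqxx.
- have [i kerZ kerS] := exists_irr_separating nsZG not_sSZ.
  by exists i => //; rewrite irr1_over_frobenius_section.
have [|i _ kerZ] := exists_irr_separating (normal1 G) (K := Z).
  by rewrite subG1.
by exists i => //; rewrite irr1_over_center.
Qed.

Let sG'M : (G^`(1))%g \subset M.
Proof.
rewrite der1_min ?normal_norm // cyclic_abelian // prime_cyclic //.
by rewrite card_quotient ?normal_norm // iMG.
Qed.

Let S_comm (H : {group gT}) g :
  S \subset H -> H \subset G -> g \in H -> g \notin P -> S \subset [~: S, H] <*> Z.
Proof.
move=> sSH sHG Hg notPg; apply/subsetP=> x Sx.
have [s Ss [z Zz Es]] := regS (subsetP sHG g Hg) notPg Sx.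
have -> : x = ([~ s, g] * z^-1)%g by rewrite commgEl Es mulKg mulgK.
by rewrite groupM ?groupV ?(subsetP (joing_subr _ _) z) // mem_gen // inE mem_commg.
Qed.

(** The derived series goes down through M, S and Z. Conversely, commuting S with an element of G'
    outside P shows that S lies in G'' Z. Since Z centralizes G'', G''' = 1 would make S abelian. *)
Lemma derived_length_chain : derived_length_eq G 4.
Proof.
have sG2P : (G^`(2))%g \subset P.
  by apply: subset_trans sSP; apply: subset_trans sM'S; apply: (dergS 1 sG'M).
have sG3Z : (G^`(3))%g \subset Z by apply: subset_trans sP'Z; apply: (dergS 1 sG2P).
rewrite /derived_length_eq; apply/andP; split.
  rewrite -subG1; apply: subset_trans (dergS 1 sG3Z) _.
  by rewrite subG1; apply/eqP/derG1P; rewrite cyclic_abelian // prime_cyclic // oZ.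
have [g Gg notMg] : exists2 g, g \in G & g \notin M.
  apply/subsetPn; apply: contraL (prime_gt1 pr_q) => sGM.
  by rewrite -iMG -leqNgt (eqP (etrans (indexg_eq1 _ _) sGM)).
have sZG1 : Z \subset (G^`(1))%g.
  apply/subsetP=> z Zz; have [z' Zz' Ez'] := regZ Gg notMg Zz.
  have -> : z = [~ z', g] by rewrite commgEl Ez' mulKg.
  by apply: mem_commg => //; rewrite (subsetP (normal_sub nsZG)).
have /subsetPn[h G'h notPh] : ~~ ((G^`(1))%g \subset P).
  by apply: contra sPRG => ?; apply: subset_trans (commSg _ sRG) _.
have sSG := normal_sub nsSG.
have sG'G := der_sub 1 G.
have sSG1 : S \subset (G^`(1))%g.
  apply: subset_trans (S_comm sSG (subxx _) (subsetP sG'G h G'h) notPh) _.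
  by rewrite join_subG sZG1 commSg.
have sSG2 : S \subset (G^`(2))%g <*> Z.
  apply: subset_trans (S_comm sSG1 sG'G G'h notPh) _.
  by rewrite genS // setSU // commSg.
apply: contra not_cSS => /eqP G3; apply: abelianS sSG2 _.
rewrite abelianY; apply/and3P; split.
- by apply/derG1P; rewrite -G3.
- by rewrite cyclic_abelian // prime_cyclic // oZ.
by rewrite centsC (subset_trans sG2P) // (subset_trans sPM).
Qed.

Let sZS1 : Z \subset (S^`(1))%g.
Proof.
have /prime_subgroupVti : prime #|Z| by rewrite oZ.
case/(_ [group of (S^`(1))%g]) => // tiZ; case/negP: not_cSS.
apply/derG1P/trivgP; rewrite /= -tiZ subsetI subxx /=.
exact: subset_trans (dergS 1 sSP) sP'Z.
Qed.

(** Were some element of F(G) outside P, commutators with it would cover S modulo Z, and Z lies in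
    S'; then S is inside [S, F(G)], so S = 1 by nilpotency. *)
Lemma Fitting_chain : 'F(G) = P.
Proof.
apply/eqP; rewrite eqEsubset; apply/andP; split; last first.
  apply: Fitting_max => //; apply: (@pgroup_nil _ p); rewrite /pgroup oP.
  by rewrite pnatX pnat_id.
apply: contraR not_cSS => /subsetPn[g Fg notPg].
have sPF : P \subset 'F(G).
  apply: Fitting_max => //; apply: (@pgroup_nil _ p); rewrite /pgroup oP.
  by rewrite pnatX pnat_id.
have sSF := subset_trans sSP sPF.
have nilF := Fitting_nil G.
suffices /eqP-> : S :==: 1%g by exact: abelian1.
apply: (implyP (forallP nilF S)); rewrite subsetI sSF /=.
apply: subset_trans (S_comm sSF (Fitting_sub G) Fg notPg) _.
by rewrite join_subG subxx (subset_trans sZS1) // commgS.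
Qed.

Lemma quotient_Fitting_chain_not_nil : ~~ nilpotent (G / P)%g.
Proof.
apply: contra not_sRP => /forallP/(_ [group of R / P]%g)/implyP.
rewrite /= subsetI quotientS //= => /(_ _)/eqP nil.
have nPR := subset_trans sRG (normal_norm nsPG).
rewrite -quotient_sub1 // nil ?sub1G //.
rewrite -quotientR ?(normal_norm nsPG) //.
apply: subset_trans (quotientS _ sR_RG) _.
by rewrite quotientYidr // (subset_trans _ (normal_norm nsPG)) // comm_subG.
Qed.

(** The second Fitting subgroup [L] contains M, as M is abelian modulo P; hence G / [L] is abelian
    and the third is G. [L] is proper because G / P is not nilpotent. *)
Lemma fitting_height_chain : fitting_height_eq G 3.
Proof.
have F1 : upper_fitting G 1 = P.
  have injc : 'injm (coset (1%g : {set gT})).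
    by rewrite ker_coset.
  rewrite /= -Fitting_chain.
  have -> : 'F(G / 1)%g = ('F(G) / 1)%g.
    by rewrite -(injmF Fitting_igFun injc) ?norms1.
  by rewrite quotientGK // normal1.
have F2 : upper_fitting G 2 = (coset P @*^-1 'F(G / P))%g.
  by rewrite -[LHS]/(coset (upper_fitting G 1) @*^-1 'F(G / upper_fitting G 1))%g F1.
set L := (coset P @*^-1 'F(G / P))%G.
have nsLG : L <| G.
  by rewrite -(quotientGK nsPG) cosetpre_normal Fitting_normal.
have F3 : upper_fitting G 3 = (coset L @*^-1 'F(G / L))%g.
  by rewrite -[LHS]/(coset (upper_fitting G 2) @*^-1 'F(G / upper_fitting G 2))%g F2.
have sML : M \subset L.
  rewrite -sub_quotient_pre ?(subset_trans sMG) ?normal_norm //.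
  apply: Fitting_max; first exact: quotient_normal.
  by apply: abelian_nil; rewrite sub_der1_abelian // (subset_trans sM'S).
rewrite /fitting_height_eq F3 F2; apply/andP; split.
  have abGL : abelian (G / L)%g by rewrite sub_der1_abelian // (subset_trans sG'M).
  by rewrite nilpotent_Fitting ?abelian_nil // quotientGK.
apply: contra quotient_Fitting_chain_not_nil => /eqP eqLG.
by rewrite -{1}eqLG cosetpreK Fitting_nil.
Qed.

Lemma solvable_chain : solvable G.
Proof.
by apply/derivedP; exists 4; have /andP[/eqP-> _] := derived_length_chain.
Qed.

End Chain.

(** * Heisenberg groups with operators *)

Record additive_action (gT : finGroupType) (V : finZmodType) := AdditiveAction {
  aact :> gT -> V -> V;
  aactD : forall g, {morph aact g : u v / u + v};
  aact1 : forall v, aact 1%g v = v;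
  aactM : forall g h v, aact (g * h)%g v = aact g (aact h v)
}.

Section AdditiveAction.

Variables (gT : finGroupType) (V : finZmodType) (a : additive_action gT V).

Lemma aact0 g : a g 0 = 0.
Proof. by apply: (addrI (a g 0)); rewrite -aactD !addr0. Qed.

Lemma aactKV g : cancel (a g^-1%g) (a g).
Proof. by move=> v; rewrite -aactM mulgV aact1. Qed.

Lemma aactN g v : a g (- v) = - a g v.
Proof. by apply/eqP; rewrite -addr_eq0 -aactD addNr aact0. Qed.

(** The map v |-> a g v - v is injective on the finite set A by fixed-point freeness, hence onto
    A. *)
Lemma fixfree_displacement (A : {set V}) g :
    (forall u v, u \in A -> v \in A -> u - v \in A) ->
    (forall u, u \in A -> a g u \in A) -> (forall v, v \in A -> a g v = v -> v = 0) ->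
  forall u, u \in A -> exists2 v, v \in A & a g v = v + u.
Proof.
move=> AB Aa fixA u Au; pose f v := a g v - v.
have f_inj : {in A &, injective f}.
  move=> v w Av Aw /(canRL (subrK v)) E.
  apply/eqP; rewrite -subr_eq0; apply/eqP/fixA; first exact: AB.
  by rewrite aactD aactN E /f addrAC [_ - w - _]addrAC subrr add0r addrC.
have fA : f @: A = A.
  apply/eqP; rewrite eqEcard card_in_imset // leqnn andbT.
  by apply/subsetP=> _ /imsetP[v Av ->]; rewrite AB ?Aa.
by move: Au; rewrite -{1}fA => /imsetP[v Av ->]; exists v; rewrite // addrC subrK.
Qed.

End AdditiveAction.

Record heisenberg_data := HeisenbergData {
  hG : finGroupType; hX : finZmodType; hY : finZmodType; hZ : finZmodType;
  hB : hX -> hY -> hZ;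
  aX : additive_action hG hX; aY : additive_action hG hY; aZ : additive_action hG hZ;
  hBDl : forall y, {morph hB^~ y : x x' / x + x'};
  hBDr : forall x, {morph hB x : y y' / y + y'};
  hB_act : forall g x y, hB (aX g x) (aY g y) = aZ g (hB x y)
}.

(* The tuple (g, x, y, z) stands for the product of the Heisenberg matrix
   [[1, x, z], [0, 1, y], [0, 0, 1]] by g in the semidirect product. *)
Definition heisenberg (D : heisenberg_data) : Type := (hG D * hX D * hY D * hZ D)%type.

HB.instance Definition _ D := Finite.on (heisenberg D).

Section HeisenbergGroup.

Variable D : heisenberg_data.
Implicit Types s t : heisenberg D.

Definition heis_mul s t : heisenberg D :=
  let: (g, x, y, z) := s in let: (g', x', y', z') := t in
  ((g * g')%g, x + aX D g x', y + aY D g y', z + aZ D g z' + hB x (aY D g y')).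

Definition heis_one : heisenberg D := (1%g, 0, 0, 0).

Lemma hB0l y : hB (0 : hX D) y = 0.
Proof. by apply: (addrI (hB 0 y)); rewrite -hBDl !addr0. Qed.

Lemma hB0r x : hB x (0 : hY D) = 0.
Proof. by apply: (addrI (hB x 0)); rewrite -hBDr !addr0. Qed.

Definition heis_inv s : heisenberg D :=
  let: (g, x, y, z) := s in
  (g^-1%g, - aX D g^-1%g x, - aY D g^-1%g y, aZ D g^-1%g (hB x y - z)).

Lemma hBNl x (y : hY D) : hB (- x) y = - hB x y.
Proof. by apply/eqP; rewrite -addr_eq0 -hBDl addNr hB0l. Qed.

Lemma heis_mulA : associative heis_mul.
Proof.
move=> [[[g1 x1] y1] z1] [[[g2 x2] y2] z2] [[[g3 x3] y3] z3] /=.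
rewrite !aactD !aactM mulgA !hBDr !hBDl !hB_act !addrA; congr (_, _).
rewrite -!addrA; do 2!congr (_ + _).
by rewrite [RHS]addrCA; congr (_ + _); rewrite addrC -addrA.
Qed.

Lemma heis_mul1 : left_id heis_one heis_mul.
Proof.
by move=> [[[g x] y] z] /=; rewrite mul1g !aact1 hB0l !add0r addr0.
Qed.

Lemma heis_mulV : left_inverse heis_one heis_inv heis_mul.
Proof.
move=> [[[g x] y] z] /=; rewrite mulVg !addNr -aactD subrK.
by rewrite hBNl hB_act subrr.
Qed.

HB.instance Definition _ := Finite_isGroup.Build (heisenberg D) heis_mulA heis_mul1 heis_mulV.

End HeisenbergGroup.

Section HeisenbergSubgroups.

Variable D : heisenberg_data.
Local Notation T := (heisenberg D).
Implicit Types (C : {group hG D}) (A : {set hX D}) (E : {set hY D}) (K : {set hZ D}).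

Lemma heis_mulE (g g' : hG D) x x' y y' z z' :
  (((g, x, y, z) : T) * ((g', x', y', z') : T))%g =
  ((g * g')%g, x + aX D g x', y + aY D g y', z + aZ D g z' + hB x (aY D g y')).
Proof. by []. Qed.

Definition heis_set (C : {set hG D}) A E K : {set T} := setX (setX (setX C A) E) K.

Lemma in_heis_set (C : {set hG D}) A E K g x y z :
  ((g, x, y, z) \in heis_set C A E K) = [&& g \in C, x \in A, y \in E & z \in K].
Proof. by rewrite !inE -!andbA. Qed.

Lemma heis_setP (C : {set hG D}) A E K g x y z :
  (g, x, y, z) \in heis_set C A E K -> [/\ g \in C, x \in A, y \in E & z \in K].
Proof. by rewrite in_heis_set => /and4P. Qed.

Lemma heis_set1P A E K g x y z :
  (g, x, y, z) \in heis_set 1%g A E K -> [/\ g = 1%g, x \in A, y \in E & z \in K].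
Proof. by move/heis_setP=> [/set1P]. Qed.

Lemma card_heis_set (C : {set hG D}) A E K :
  #|heis_set C A E K| = (#|C| * #|A| * #|E| * #|K|)%N.
Proof. by rewrite !cardsX. Qed.

Definition act_closed (V : finZmodType) (a : additive_action (hG D) V)
    (C : {set hG D}) (A : {set V}) :=
  [/\ 0 \in A, forall u v, u \in A -> v \in A -> u + v \in A &
      forall g u, g \in C -> u \in A -> a g u \in A].

Lemma heis_set_group C A E K :
    act_closed (aX D) C A -> act_closed (aY D) C E -> act_closed (aZ D) C K ->
    (forall x y, x \in A -> y \in E -> hB x y \in K) ->
  group_set (heis_set C A E K).
Proof.
move=> [A0 AD Aa] [E0 ED Ea] [K0 KD Ka] AEK; apply/group_setP; split.
  by rewrite in_heis_set group1 A0 E0.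
move=> [[[g x] y] z] [[[g' x'] y'] z']; rewrite heis_mulE !in_heis_set.
case/and4P=> Cg Ax Ey Kz /and4P[Cg' Ax' Ey' Kz'].
by rewrite groupM // AD ?Aa // ED ?Ea // KD ?KD ?Ka ?AEK ?Ea.
Qed.

Lemma act_closedT V (a : additive_action (hG D) V) C : act_closed a C setT.
Proof. by split=> [|u v _ _|g u _ _]; rewrite inE. Qed.

Lemma act_closed0 V (a : additive_action (hG D) V) C : act_closed a C [set 0].
Proof.
split=> [|u v /set1P-> /set1P->|g u _ /set1P->]; rewrite inE //.
  by rewrite addr0.
by rewrite aact0.
Qed.

(** The inverse of g appears because [x ^ g] is a right action while [aX], [aY], [aZ] are left
    actions. *)
Lemma heis_conj1 (g : hG D) u v w x y z :
  (((1%g, x, y, z) : T) ^ ((g, u, v, w) : T))%g =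
    (1%g, aX D g^-1%g x, aY D g^-1%g y,
     aZ D g^-1%g (z + hB x v - hB u y)).
Proof.
apply: (mulgI ((g, u, v, w) : T)); rewrite conjgE mulKVg !heis_mulE.
rewrite mul1g mulg1 !aact1 !aactKV addrA subrK addrA.
by rewrite [u + x]addrC [v + y]addrC [w + z]addrC.
Qed.

(** The right factor, applied to two products in opposite order, is the explicit commutator wanted
    by [commg_sub_of_swap]. *)
Lemma heis_ldiv (g : hG D) x x' y y' z z' :
  ((g, x', y', z') : T) =
  (((g, x, y, z) : T) * ((1%g, aX D g^-1%g (x' - x), aY D g^-1%g (y' - y),
                          aZ D g^-1%g (z' - z - hB x (y' - y))) : T))%g.
Proof.
rewrite heis_mulE mulg1 !aactKV; congr (_, _, _, _); last rewrite -[RHS]addrA subrK;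
  by rewrite [RHS]addrC subrK.
Qed.

Lemma act_closedS V (a : additive_action (hG D) V) (C1 C2 : {set hG D}) (W : {set V}) :
  C1 \subset C2 -> act_closed a C2 W -> act_closed a C1 W.
Proof. by move=> /subsetP sC [A0 AD Aa]; split=> // g u /sC; apply: Aa. Qed.

End HeisenbergSubgroups.

(** * The chain inside a Heisenberg group with operators *)

Section HeisenbergChain.

Variables (D : heisenberg_data) (C R : {group hG D}) (A : {set hX D}) (E : {set hY D}).
Variables (p q n : nat).
Hypotheses (pr_p : prime p) (pr_q : prime q).
Hypotheses (oZ : #|hZ D| = p) (oX : #|hX D| = (p ^ n)%N) (oY : #|hY D| = (p ^ n)%N).
Hypotheses (nsCG : C <| [set: hG D]) (iCG : #|[set: hG D] : C| = q) (cCC : abelian C).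
Hypotheses (ntR : R != 1%G) (sRR : R \subset [~: R, [set: hG D]]).
Hypothesis aZ_C : forall g z, g \in C -> aZ D g z = z.
Hypothesis aZ_fixfree : forall g z, g \notin C -> aZ D g z = z -> z = 0.
Hypothesis B_ndl : forall x, (forall y, hB x y = 0) -> x = 0 :> hX D.
Hypothesis B_ndr : forall y, (forall x, hB x y = 0) -> y = 0 :> hY D.
Hypotheses (A_closed : act_closed (aX D) [set: hG D] A) (AN : forall x, x \in A -> - x \in A).
Hypotheses (E_closed : act_closed (aY D) [set: hG D] E) (EN : forall y, y \in E -> - y \in E).
Hypothesis aX_C : forall g x, g \in C -> aX D g x - x \in A.
Hypothesis aY_C : forall g y, g \in C -> aY D g y - y \in E.
Hypothesis aX_fixfree : forall g x, g != 1%g -> x \in A -> aX D g x = x -> x = 0.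
Hypothesis aY_fixfree : forall g y, g != 1%g -> y \in E -> aY D g y = y -> y = 0.
Hypothesis AE_pairing : exists2 x, x \in A & exists2 y, y \in E & hB x y != 0.

Local Notation T := (heisenberg D).

Let gP := heis_set_group (act_closedT (aX D) 1%G) (act_closedT (aY D) 1%G)
  (act_closedT (aZ D) 1%G) (fun x y _ _ => in_setT (hB x y)).
Let gM := heis_set_group (act_closedT (aX D) C) (act_closedT (aY D) C)
  (act_closedT (aZ D) C) (fun x y _ _ => in_setT (hB x y)).
Let gR := heis_set_group (act_closedT (aX D) R) (act_closedT (aY D) R)
  (act_closedT (aZ D) R) (fun x y _ _ => in_setT (hB x y)).
Let gS := heis_set_group (act_closedS (subsetT 1%G) A_closed)
  (act_closedS (subsetT 1%G) E_closed)
  (act_closedT (aZ D) 1%G) (fun x y _ _ => in_setT (hB x y)).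
Let gZ := heis_set_group (act_closed0 (aX D) 1%G) (act_closed0 (aY D) 1%G)
  (act_closedT (aZ D) 1%G) (fun x y _ _ => in_setT (hB x y)).

Let pair0 (x : hX D) (y : hY D) : x \in [set 0] -> y \in [set: hY D] -> hB x y \in [set 0].
Proof. by move=> /set1P-> _; rewrite hB0l inE. Qed.
Let gU := heis_set_group (act_closed0 (aX D) 1%G) (act_closedT (aY D) 1%G)
  (act_closed0 (aZ D) 1%G) pair0.
Let gB := heis_set_group (act_closed0 (aX D) C) (act_closedT (aY D) C)
  (act_closedT (aZ D) C) (fun x y _ _ => in_setT (hB x y)).

Let G := [set: T]%G.
(** In product notation: P = X Y Z, M = P C, RP = P R, S = A E Z, U = Y, BB = Y Z C. *)
Let P := Group gP. Let M := Group gM. Let RP := Group gR. Let S := Group gS.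
Let Z := Group gZ. Let U := Group gU. Let BB := Group gB.

Let normalT (H : {group T}) : (forall x g, x \in H -> x ^ g \in H)%g -> H <| G.
Proof.
move=> nH; rewrite /normal subsetT; apply/subsetP=> g _; rewrite inE.
by apply/subsetP=> _ /imsetP[x Hx ->]; apply: nH.
Qed.

Let nsPG : P <| G.
Proof.
apply: normalT => -[[[g x] y] z] [[[h u] v] w] /heis_set1P[-> _ _ _].
by rewrite heis_conj1 in_heis_set !inE eqxx.
Qed.

Let nsZG : Z <| G.
Proof.
apply: normalT => -[[[g x] y] z] [[[h u] v] w] /heis_set1P[-> /set1P-> /set1P-> _].
by rewrite heis_conj1 in_heis_set !inE !aact0 !eqxx.
Qed.

Let nsSG : S <| G.
Proof.
apply: normalT => -[[[g x] y] z] [[[h u] v] w] /heis_set1P[-> Ax Ey _].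
have [[_ _ Aa] [_ _ Ea]] := (A_closed, E_closed).
by rewrite heis_conj1 in_heis_set Aa ?Ea ?inE ?eqxx.
Qed.

Let nsMG : M <| G.
Proof.
apply: normalT => -[[[g x] y] z] [[[h u] v] w] /heis_setP[Cg _ _ _].
rewrite conjgE in_heis_set !inE !andbT -conjgE.
by rewrite memJ_norm // (subsetP (normal_norm nsCG)) ?inE.
Qed.

Let oP : #|P| = (p ^ n.*2.+1)%N.
Proof.
by rewrite /= card_heis_set cards1 !cardsT oX oY oZ mul1n -expnD addnn -expnSr.
Qed.

Let oZZ : #|Z| = p.
Proof. by rewrite /= card_heis_set !cards1 !cardsT oZ !mul1n. Qed.

Let oG : #|G| = (#|hG D| * #|hX D| * #|hY D| * #|hZ D|)%N.
Proof. by rewrite cardsT /heisenberg !card_prod. Qed.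

Let index_T (H : {group T}) m : #|G| = (m * #|H|)%N -> #|G : H| = m.
Proof. by move=> oGm; rewrite -divgS ?subsetT // oGm mulnK ?cardG_gt0. Qed.

Let oGC : #|hG D| = (q * #|C|)%N.
Proof. by rewrite -cardsT -iCG mulnC Lagrange ?subsetT. Qed.

Let iMG : #|G : M| = q.
Proof.
apply: index_T; rewrite oG oGC /= card_heis_set !cardsT.
by rewrite !mulnA.
Qed.

Let iBG : #|G : BB| = (p ^ n * q)%N.
Proof.
apply: index_T; rewrite oG oGC /= card_heis_set !cardsT cards1 muln1.
by rewrite oX -!mulnA [(#|C| * _)%N]mulnCA mulnCA.
Qed.

Let iPG : #|G : P| = #|hG D|.
Proof.
apply: index_T; rewrite oG /= card_heis_set !cardsT cards1 mul1n.
by rewrite !mulnA.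
Qed.

Let sub_heis (C1 C2 : {set hG D}) (A1 A2 : {set hX D}) (E1 E2 : {set hY D})
    (K1 K2 : {set hZ D}) :
  C1 \subset C2 -> A1 \subset A2 -> E1 \subset E2 -> K1 \subset K2 ->
  heis_set C1 A1 E1 K1 \subset heis_set C2 A2 E2 K2.
Proof. by move=> sC sA sE sK; rewrite !setXS. Qed.

Let sZS : Z \subset S.
Proof.
have [[A0 _ _] [E0 _ _]] := (A_closed, E_closed).
by apply: sub_heis; rewrite ?sub1set.
Qed.

Let sSP : S \subset P. Proof. by apply: sub_heis; rewrite ?subsetT. Qed.
Let sPM : P \subset M. Proof. by apply: sub_heis; rewrite ?sub1G. Qed.
Let sUB : U \subset BB. Proof. by apply: sub_heis; rewrite ?sub1G ?subsetT. Qed.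
Let sUP : U \subset P. Proof. by apply: sub_heis; rewrite ?sub1G ?subsetT. Qed.

Let cZM : M \subset 'C(Z).
Proof.
rewrite centsC; apply/centsP=> -[[[g x] y] z] /heis_set1P[-> /set1P-> /set1P-> _].
move=> [[[h u] v] w] /heis_setP[Ch _ _ _]; rewrite /commute !heis_mulE.
by rewrite mul1g mulg1 !aact0 !aact1 hB0l hB0r !add0r !addr0 aZ_C // addrC.
Qed.

Let sP'Z : (P^`(1))%g \subset Z.
Proof.
apply: commg_sub_of_swap => -[[[g x] y] z] [[[g' x'] y'] z'].
move=> /heis_set1P[-> _ _ _] /heis_set1P[-> _ _ _].
exists (1%g, 0, 0, hB x y' - hB x' y); first by rewrite in_heis_set !inE !eqxx.
rewrite !heis_mulE !mul1g !aact1 !addr0 !hB0r addr0 addrC [y + _]addrC.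
congr (_, _, _, _).
by rewrite [z + z']addrC -[RHS]addrA [hB x' y + _]addrC subrK.
Qed.

Let tiUZ : (U :&: Z = 1)%g.
Proof.
apply/trivgP/subsetP=> -[[[g x] y] z] /setIP[/heis_set1P[-> /set1P-> _ /set1P->]].
by case/heis_set1P=> _ _ /set1P-> _; rewrite inE.
Qed.

(** Commuting with Y puts x in the left radical of [hB], commuting with X puts y in the right one;
    both are zero. *)
Let sZPZ : 'Z(P) \subset Z.
Proof.
apply/subsetP=> -[[[g x] y] z] /centerP[/heis_set1P[-> _ _ _] cP].
have x0 : x = 0.
  apply: B_ndl => y'; have := cP (1%g, 0, y', 0).
  rewrite in_heis_set !inE eqxx => /(_ isT).
  rewrite /commute !heis_mulE !aact1 hB0l !add0r !addr0 => -[_].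
  by rewrite -[RHS]addr0 => /addrI.
have y0 : y = 0.
  apply: B_ndr => x'; have := cP (1%g, x', 0, 0).
  rewrite in_heis_set !inE eqxx => /(_ isT).
  rewrite /commute !heis_mulE !aact1 hB0r !add0r !addr0 => -[_].
  by rewrite -[LHS]addr0 => /addrI.
by rewrite x0 y0 in_heis_set !inE !eqxx.
Qed.

Let not_cSS : ~~ abelian S.
Proof.
have [x Ax [y Ey nz]] := AE_pairing.
have [[A0 _ _] [E0 _ _]] := (A_closed, E_closed).
apply: contra nz => /centsP/(_ (1%g, x, 0, 0)).
rewrite in_heis_set !inE eqxx Ax E0 => /(_ isT (1%g, 0, y, 0)).
rewrite in_heis_set !inE eqxx Ey A0 => /(_ isT).
by rewrite /commute !heis_mulE !aact1 !hB0l !add0r => /(congr1 snd) /= ->.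
Qed.

(** C is abelian and acts trivially on X / A and Y / E. *)
Let sM'S : (M^`(1))%g \subset S.
Proof.
have dispX g x : g \in C -> exists2 a, a \in A & aX D g x = x + a.
  by move=> Cg; exists (aX D g x - x); rewrite ?aX_C // addrC subrK.
have dispY g y : g \in C -> exists2 e, e \in E & aY D g y = y + e.
  by move=> Cg; exists (aY D g y - y); rewrite ?aY_C // addrC subrK.
have [[_ AD Aa] [_ ED Ea]] := (A_closed, E_closed).
apply: commg_sub_of_swap => -[[[g x] y] z] [[[h u] v] w].
move=> /heis_setP[Cg _ _ _] /heis_setP[Ch _ _ _].
rewrite !heis_mulE (centsP cCC g Cg h Ch).
eexists; last exact: heis_ldiv.
have [a Aa1 ->] := dispX g u Cg; have [b Ab ->] := dispX h x Ch.
have [c Ec ->] := dispY g v Cg; have [d Ed ->] := dispY h y Ch.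
have disp (V : zmodType) (x' u' a' b' : V) : x' + (u' + a') - (u' + (x' + b')) = a' - b'.
  by rewrite addrCA opprD addrACA subrr add0r opprD addrACA subrr add0r.
by rewrite !disp in_heis_set !inE eqxx Aa ?Ea ?inE // ?AD ?ED ?AN ?EN.
Qed.

Let sB'U : (BB^`(1))%g \subset U.
Proof.
apply: commg_sub_of_swap => -[[[g x] y] z] [[[h u] v] w].
move=> /heis_setP[Cg /set1P-> _ _] /heis_setP[Ch /set1P-> _ _].
rewrite !heis_mulE (centsP cCC g Cg h Ch).
eexists; last exact: heis_ldiv.
rewrite in_heis_set !inE !aact0 !hB0l !addr0 subrr aact0 hB0l.
by rewrite !aZ_C ?groupV ?groupM // opprD addrA addrK subrr subr0 !eqxx.
Qed.

Let regZ g z : g \in G -> g \notin M -> z \in Z ->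
  exists2 z', z' \in Z & (z' ^ g = z' * z)%g.
Proof.
case: g z => [[[g x] y] z] [[[h u] v] w] _.
move=> notM /heis_set1P[-> /set1P-> /set1P-> _].
have notCg : g \notin C by move: notM; rewrite in_heis_set !inE !andbT.
have [w' _ Ew'] : exists2 w', w' \in [set: hZ D] & aZ D g^-1%g w' = w' + w.
  apply: fixfree_displacement => [a b _ _|a _|a _|]; rewrite ?inE //.
  by apply: aZ_fixfree; rewrite groupV.
exists (1%g, 0, 0, w'); first by rewrite in_heis_set !inE !eqxx.
rewrite heis_conj1 heis_mulE mul1g !aact0 !aact1 !hB0l ?hB0r.
by rewrite ?subr0 !addr0 Ew'.
Qed.

Let regS g x : g \in G -> g \notin P -> x \in S ->
  exists2 s, s \in S & exists2 z, z \in Z & (s ^ g = s * (x * z))%g.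
Proof.
have [[A0 AD Aa] [E0 ED Ea]] := (A_closed, E_closed).
case: g x => [[[g x] y] z] [[[h u] v] w] _.
move=> notP /heis_set1P[-> Au Ev _].
have g1 : g != 1%g by move: notP; rewrite in_heis_set !inE !andbT.
have g1' : g^-1%g != 1%g by rewrite invg_eq1.
have [a Aa1 Ea1] : exists2 a, a \in A & aX D g^-1%g a = a + u.
  apply: fixfree_displacement => // [a b Ha Hb|a|a]; first by rewrite AD ?AN.
    by apply: Aa; rewrite inE.
  exact: aX_fixfree.
have [b Eb1 Eb] : exists2 b, b \in E & aY D g^-1%g b = b + v.
  apply: fixfree_displacement => // [b c Hb Hc|b|b]; first by rewrite ED ?EN.
    by apply: Ea; rewrite inE.
  exact: aY_fixfree.
exists (1%g, a, b, 0); first by rewrite in_heis_set !inE eqxx Aa1 Eb1.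
rewrite heis_conj1 Ea1 Eb.
(* The choice of a and b settles the X and Y coordinates. In Z, the conjugate has coordinate c and
   the product w + hB a v; the witness is the difference. *)
set c := aZ _ _ _; exists (1%g, 0, 0, c - (w + hB a v)).
  by rewrite in_heis_set !inE !eqxx.
rewrite !heis_mulE !mul1g !aact1 !addr0 !hB0r !addr0 add0r.
by rewrite addrAC addrC subrK.
Qed.

Let sRP_RG : RP \subset [~: RP, G] <*> P.
Proof.
pose f (g : hG D) : T := (g, 0, 0, 0).
have fM : {in [set: hG D] &, {morph f : g h / (g * h)%g}}.
  by move=> g h _ _; rewrite heis_mulE !aact0 hB0l !addr0.
pose phi := Morphism fM.
apply/subsetP=> -[[[g x] y] z] /heis_setP[Rg _ _ _].
rewrite (heis_ldiv g 0 x 0 y 0 z) groupM //; last first.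
  by rewrite (subsetP (joing_subr _ _)) // in_heis_set !inE eqxx.
apply: (subsetP (joing_subl _ _)).
have: phi g \in (phi @* [~: R, [set: hG D]])%g.
  by rewrite mem_morphim ?inE // (subsetP sRR).
rewrite morphimR ?subsetT //; apply: subsetP; apply: commgSS; last exact: subsetT.
apply/subsetP=> _ /morphimP[h _ Rh ->].
by rewrite in_heis_set Rh !inE.
Qed.

Let not_sRP : ~~ (RP \subset P).
Proof.
have /trivgPn[r Rr r1] := ntR.
apply/subsetPn; exists (r, 0, 0, 0); rewrite in_heis_set !inE ?Rr //.
by rewrite !andbT.
Qed.

Lemma heisenberg_chain : [/\ solvable G, derived_length_eq G 4, fitting_height_eq G 3 &
  cd G =i [seq (d%:R : algC) | d <- [:: 1%N; q; #|hG D|; p ^ n * q]%N]].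
Proof.
have sRG := subsetT RP; have sBG := subsetT BB; rewrite -iPG; split.
- exact: (solvable_chain pr_p pr_q nsZG nsSG nsMG sSP sPM oZZ iMG cZM sP'Z sM'S
    not_cSS regZ regS sRG not_sRP sRP_RG).
- exact: (derived_length_chain pr_p pr_q nsZG nsSG nsMG sSP sPM oZZ iMG cZM sP'Z sM'S
    not_cSS regZ regS sRG not_sRP sRP_RG).
- exact: (fitting_height_chain pr_p pr_q nsPG nsMG sSP oZZ oP iMG sP'Z sM'S
    not_cSS regS sRG not_sRP sRP_RG).
exact: (cd_chain pr_p pr_q nsZG nsSG nsPG nsMG sZS sSP sPM oZZ oP iMG cZM sP'Z sM'S
  sZPZ not_cSS regZ regS sRG not_sRP sRP_RG sUB sBG sUP sB'U tiUZ iBG).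
Qed.

End HeisenbergChain.

(** * The multiplicative group of a Dickson near-field *)

Section DicksonArithmetic.

Variables p q : nat.
Local Open Scope nat_scope.
Hypotheses (pr_p : prime p) (pr_q : prime q) (q_odd : odd q) (q_dv : q %| p.-1).

Let N := (p ^ q).-1.
Let Phi := (\sum_(i < q) p ^ i)%N.

Let p_gt0 : (0 < p)%N := prime_gt0 pr_p.
Let q_gt0 : (0 < q)%N := prime_gt0 pr_q.

Lemma dickson_factor : N = (p.-1 * Phi)%N.
Proof. exact: predn_exp. Qed.

(** Since p^q is 1 modulo N, the Frobenius twist in the Dickson group law depends only on the
    exponent modulo q. *)
Lemma expn_mod_dickson a b : a = b %[mod q] -> p ^ a = p ^ b %[mod N].
Proof.
have red c : p ^ c = p ^ (c %% q) %[mod N].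
  have pq1 : p ^ q = 1 %[mod N].
    by rewrite -[(p ^ q)%N]prednK ?expn_gt0 ?p_gt0 // -addn1 modnDl.
  rewrite {1}(divn_eq c q) expnD [c %/ q * q]mulnC expnM.
  by rewrite -modnMml -modnXm pq1 modnXm exp1n modnMml mul1n.
by move=> eab; rewrite red eab -red.
Qed.

Lemma expn_mod_q a : p ^ a = 1 %[mod q].
Proof.
have p1 : p = 1 %[mod q].
  by apply/eqP; rewrite eqn_mod_dvd // subn1.
by rewrite -modnXm p1 modnXm exp1n.
Qed.

(** Binomial expansion of (1 + (p - 1))^i, where q^2 divides (p - 1)^2. *)
Lemma expn_mod_q2 i : p ^ i = 1 + i * p.-1 %[mod q ^ 2].
Proof.
elim: i => [|i IHi]; first by rewrite expn0 mul0n.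
rewrite expnS -modnMmr IHi modnMmr -{1}(prednK p_gt0) mulSn mulnDr muln1.
have /dvdnP[t ->] := q_dv.
rewrite mulSn [(t * q + i * (t * q))%N]addnC addnA -[RHS]modnDmr.
rewrite (_ : t * q * (i * (t * q)) = t * i * t * q ^ 2)%N; last first.
  by rewrite -(mulnn q) !mulnA; lia.
by rewrite addnC modnMDl modnDmr addnA.
Qed.

Lemma dickson_sum_mod : Phi = q %[mod q ^ 2].
Proof.
rewrite /Phi -modn_summ (eq_bigr (fun i : 'I_q => (1 + i * p.-1) %% q ^ 2)); last first.
  by move=> i _; apply: expn_mod_q2.
rewrite modn_summ.
rewrite big_split sum1_card card_ord -big_distrl /= -(big_mkord predT id) bin2_sum.
have /dvdnP[t ->] := q_dv.
(* Here q must be odd. The correction (p - 1) q (q - 1) / 2 is then divisible by q^2. *)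
have /dvdnP[c ->] : q %| 'C(q, 2).
  by apply: prime_dvd_bin => //=; rewrite ltn_neqAle prime_gt1 // andbT; case: eqP q_odd => // <-.
by rewrite mulnACA mulnn addnC modnMDl.
Qed.

Lemma dvdn_dickson_sum : q %| Phi.
Proof.
have dq2 : q %| q ^ 2 by rewrite dvdn_exp.
by rewrite /dvdn -(modn_dvdm _ dq2) dickson_sum_mod modn_dvdm // modnn.
Qed.

Lemma ndvdn_dickson_sum : ~~ (q ^ 2 %| Phi).
Proof.
by rewrite /dvdn dickson_sum_mod modn_small -?lt0n // -(mulnn q) ltn_Pmull ?prime_gt1.
Qed.

Let m := Phi %/ q.

(** [Phi] is q modulo p - 1, so a common prime divisor of p - 1 and m divides q, hence is q; but
    then q^2 would divide [Phi] = m q. *)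
Lemma coprime_dickson_sum : coprime p.-1 m.
Proof.
have Phi_eq : Phi = m * q by rewrite divnK // dvdn_dickson_sum.
have p1_gt0 : 0 < p.-1 by rewrite -subn1 subn_gt0 prime_gt1.
apply: contraT => /eqP/eqP; rewrite -/(coprime _ _) => ncop.
have g_gt1 : 1 < gcdn p.-1 m by rewrite ltn_neqAle eq_sym ncop gcdn_gt0 p1_gt0.
have r_pr := pdiv_prime g_gt1; set r := pdiv _ in r_pr.
have := pdiv_dvd (gcdn p.-1 m); rewrite dvdn_gcd -/r => /andP[r_p1 r_m].
have : Phi = q %[mod p.-1].
  rewrite /Phi -modn_summ (eq_bigr (fun=> 1 %% p.-1)) => [|i _].
    by rewrite modn_summ sum1_card card_ord.
  rewrite -modnXm (_ : p = 1 %[mod p.-1]) ?modnXm ?exp1n //.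
  by rewrite -{1}(prednK p_gt0) -addn1 modnDl.
move/eqP/(congr1 (fun b : bool => b)) => PhiE.
have r_q : r %| q.
  move: PhiE => /eqP/(congr1 (modn^~ r)); rewrite !modn_dvdm // => rE.
  by rewrite /dvdn -rE Phi_eq -/(dvdn _ _) dvdn_mulr.
have rq : r = q by apply/eqP; rewrite -dvdn_prime2.
by case/negP: ndvdn_dickson_sum; rewrite Phi_eq -(mulnn q) dvdn_pmul2r // -rq.
Qed.

Lemma dickson_sum_gt : 1 < m.
Proof.
rewrite ltn_divRL ?dvdn_dickson_sum // mul1n /Phi.
rewrite (bigD1 (Ordinal (prime_gt1 pr_q))) //= expn1; apply: leq_trans (leq_addr _ _).
by rewrite -(prednK p_gt0) ltnS dvdn_leq // -subn1 subn_gt0 prime_gt1.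
Qed.

Lemma partn_dickson : N`_q^' * (p.-1)`_q * q = N.
Proof.
have p1_gt0 : 0 < p.-1 by rewrite -subn1 subn_gt0 prime_gt1.
have Phi_eq : Phi = m * q by rewrite divnK // dvdn_dickson_sum.
have m_gt0 : 0 < m := ltnW dickson_sum_gt.
have N_gt0 : 0 < N by rewrite dickson_factor Phi_eq !muln_gt0 p1_gt0 m_gt0.
have mq : m`_q = 1.
  apply: part_p'nat; rewrite p'natE //.
  by apply: contra ndvdn_dickson_sum; rewrite Phi_eq -(mulnn q) dvdn_pmul2r.
rewrite -[RHS](partnC q N_gt0) mulnC [RHS]mulnC mulnCA; congr (_ * _).
rewrite dickson_factor Phi_eq !partnM ?muln_gt0 ?m_gt0 //.
by rewrite mq mul1n (part_pnat_id (pnat_id pr_q)) mulnC.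
Qed.

End DicksonArithmetic.

Record dickson_pair := DicksonPair {
  dp : nat; dq : nat;
  dp_prime : prime dp; dq_prime : prime dq; dq_odd : odd dq; dq_dvd : (dq %| dp.-1)%N
}.

Definition dickson_order (d : dickson_pair) := (dp d ^ dq d)%N.-1.

(* The residue [k] stands for the nonzero element [w ^+ k] of the Dickson near-field
   on F_(p^q), [w] being a generator of the multiplicative group. *)
Definition dickson (d : dickson_pair) : Type := 'I_(dickson_order d).-1.+1.

HB.instance Definition _ d := Finite.on (dickson d).

Section DicksonGroup.

Variable d : dickson_pair.
Local Notation p := (dp d).
Local Notation q := (dq d).
Local Notation N := (dickson_order d).
Local Open Scope nat_scope.

Definition dval (k : dickson d) : nat := nat_of_ord k.
Definition dick (k : nat) : dickson d := inZp k.

Let p_gt0 : 0 < p := prime_gt0 (dp_prime d).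
Let q_gt1 : 1 < q := prime_gt1 (dq_prime d).

Lemma dickson_order_gt1 : 1 < N.
Proof.
rewrite /dickson_order -subn1 ltn_subRL addn1.
have q2 : 2 < q by rewrite ltn_neqAle q_gt1 andbT; case: eqP (dq_odd d) => // <-.
have p2 := prime_gt1 (dp_prime d).
apply: (@leq_trans (2 ^ q)); last by rewrite leq_exp2r ?(ltnW q_gt1).
by apply: (@leq_trans (2 ^ 2)) => //; rewrite leq_exp2l // ltnW.
Qed.

Let NK : N.-1.+1 = N := prednK (ltnW dickson_order_gt1).

Lemma dval_dick k : dval (dick k) = k %% N.
Proof. by rewrite /dval /= NK. Qed.

Lemma ltn_dval k : dval k < N.
Proof. by rewrite -[X in _ < X]NK ltn_ord. Qed.

Lemma dval_inj k l : dval k = dval l %[mod N] -> k = l.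
Proof. by rewrite !modn_small ?ltn_dval // => /val_inj. Qed.

Lemma dvdn_q_order : q %| N.
Proof.
by rewrite /dickson_order dickson_factor dvdn_mulr ?dq_dvd.
Qed.

Lemma dickson_pexp a b : a = b %[mod q] -> p ^ a = p ^ b %[mod N].
Proof. by move=> eab; apply: expn_mod_dickson => //; apply: dp_prime. Qed.

Lemma pexp_mod_q a : p ^ a = 1 %[mod q].
Proof. by apply: expn_mod_q; [apply: dp_prime | apply: dq_dvd]. Qed.

(** Composition of v |-> w^k v^(p^k) after v |-> w^l v^(p^l), read on exponents of w. *)
Definition dmul k l := dick (dval k + p ^ dval k * dval l).
Definition dunit := dick 0.
(** The inverse l satisfies l = - p^l k modulo N, and l = -k = k (q - 1) modulo q determines p^l. *)
Definition dinv k := dick (p ^ (dval k * q.-1) * (N - dval k)).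

Lemma dval_mul k l : dval (dmul k l) = dval k + p ^ dval k * dval l %[mod N].
Proof. by rewrite dval_dick modn_mod. Qed.

Lemma dval_mul_q k l : dval (dmul k l) = dval k + dval l %[mod q].
Proof.
rewrite dval_dick modn_dvdm ?dvdn_q_order //.
by rewrite -modnDmr -modnMml pexp_mod_q modnMml mul1n modnDmr.
Qed.

Lemma dmulA : associative dmul.
Proof.
move=> k l m; apply: dval_inj; rewrite dval_mul [RHS]dval_mul.
rewrite -modnDmr -modnMmr dval_mul modnMmr modnDmr.
rewrite -[RHS]modnDml dval_mul [RHS]modnDml.
rewrite -[RHS]modnDmr -modnMml (dickson_pexp (dval_mul_q k l)) modnMml modnDmr.
by rewrite expnD mulnDr addnA mulnA.
Qed.

Lemma dmul1 : left_id dunit dmul.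
Proof.
by move=> k; apply: dval_inj; rewrite dval_mul dval_dick mod0n expn0 mul1n add0n.
Qed.

Lemma dmulV : left_inverse dunit dinv dmul.
Proof.
move=> k; apply: dval_inj; rewrite dval_mul.
have invq : dval (dinv k) = dval k * q.-1 %[mod q].
  rewrite dval_dick modn_dvdm ?dvdn_q_order // -modnMml pexp_mod_q modnMml mul1n.
  apply/eqP; rewrite -(eqn_modDr (dval k)) subnK ?(ltnW (ltn_dval k)) //.
  by rewrite -{2}[dval k]muln1 -mulnDr addn1 prednK ?(ltnW q_gt1) // modnMl (eqP dvdn_q_order).
rewrite -modnDmr -modnMml (dickson_pexp invq) modnMml modnDmr.
rewrite -modnDml [dval (dinv k)]dval_dick modn_mod modnDml -mulnDr subnK ?(ltnW (ltn_dval k)) //.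
by rewrite modnMl dval_dick mod0n mod0n.
Qed.

HB.instance Definition _ := Finite_isGroup.Build (dickson d) dmulA dmul1 dmulV.

End DicksonGroup.

Section DicksonSubgroups.

Variable d : dickson_pair.
Local Notation p := (dp d).
Local Notation q := (dq d).
Local Notation N := (dickson_order d).
Local Notation T := (dickson d).
Local Open Scope nat_scope.

Lemma dval1 : dval (1%g : T) = 0.
Proof. by rewrite dval_dick mod0n. Qed.

Lemma dvalM (k l : T) : dval (k * l)%g = dval k + p ^ dval k * dval l %[mod N].
Proof. exact: dval_mul. Qed.

Lemma dvalM_q (k l : T) : dval (k * l)%g = dval k + dval l %[mod q].
Proof. exact: dval_mul_q. Qed.

Lemma dval_eq1 (k : T) : (k == 1%g) = (N %| dval k).
Proof.
apply/eqP/idP => [->|]; first by rewrite dval1.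
by move/eqP=> k0; apply: dval_inj; rewrite k0 dval1 mod0n.
Qed.

Definition dresidue (k : T) : 'Z_q := inZp (dval k).

Let q_gt1 : 1 < q := prime_gt1 (dq_prime d).

Lemma dresidueM : {in [set: T] &, {morph dresidue : k l / (k * l)%g}}.
Proof.
move=> k l _ _; apply: val_inj; rewrite /= Zp_cast // dvalM_q.
by rewrite modnDm.
Qed.

Canonical dresidue_morphism := Morphism dresidueM.

Lemma in_dkernel k : (k \in 'ker dresidue) = (q %| dval k).
Proof.
rewrite !inE /=; apply/eqP/eqP => [/(congr1 val)|k0].
  by rewrite /= Zp_cast.
by apply: val_inj; rewrite /= Zp_cast.
Qed.

Lemma dkernel_normal : 'ker dresidue <| [set: T].
Proof. exact: ker_normal. Qed.

Lemma dkernel_index : #|[set: T] : 'ker dresidue| = q.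
Proof.
have := card_morphim dresidue_morphism [set: T]; rewrite setIid => <-.
have -> : (dresidue @* [set: T])%g = setT.
  apply/setP=> i; rewrite [RHS]inE; apply/morphimP; exists (dick d i); rewrite ?inE //.
  have iq : i < q by rewrite -[X in _ < X](Zp_cast q_gt1) ltn_ord.
  apply: val_inj; transitivity (dval (dick d i) %% q).
    by rewrite dval_dick modn_dvdm ?dvdn_q_order // modn_small.
  by congr (_ %% _); rewrite Zp_cast.
by rewrite cardsT card_ord Zp_cast.
Qed.

Lemma dvalM_ker (k l : T) : q %| dval k -> dval (k * l)%g = dval k + dval l %[mod N].
Proof.
move=> /eqP k0; rewrite dvalM -modnDmr -modnMml.
by rewrite (dickson_pexp (b := 0)) ?k0 ?mod0n // expn0 modnMml mul1n modnDmr.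
Qed.

Lemma dkernel_abelian : abelian ('ker dresidue).
Proof.
apply/centsP=> k; rewrite in_dkernel => k0 l; rewrite in_dkernel => l0.
by apply: dval_inj; rewrite !dvalM_ker // addnC.
Qed.

(** As N = q (p - 1) m, this is the subgroup of order m of the abelian kernel; it plays the role of
    R. *)
Definition dickson_residual : {set T} := [set k | q * p.-1 %| dval k].

Let m := (\sum_(i < q) p ^ i) %/ q.

Let NE : N = q * p.-1 * m.
Proof.
have Phi_eq : \sum_(i < q) p ^ i = m * q.
  by rewrite divnK // dvdn_dickson_sum ?dp_prime ?dq_prime ?dq_odd ?dq_dvd.
by rewrite /dickson_order dickson_factor Phi_eq [m * q]mulnC mulnCA mulnA.
Qed.

Lemma dickson_residual_group_set : group_set dickson_residual.
Proof.
apply/group_setP; split=> [|k l]; first by rewrite inE dval1.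
rewrite !inE => dk dl.
have dN : q * p.-1 %| N by rewrite NE dvdn_mulr.
by rewrite /dvdn -(modn_dvdm _ dN) dvalM modn_dvdm // -/(dvdn _ _) dvdn_add // dvdn_mull.
Qed.

Canonical dickson_residual_group := Group dickson_residual_group_set.

Lemma dickson_residual_nontrivial : dickson_residual_group != 1%G.
Proof.
have m1 : 1 < m by apply: dickson_sum_gt; rewrite ?dp_prime ?dq_prime ?dq_odd ?dq_dvd.
have p1 : 0 < p.-1 by rewrite -subn1 subn_gt0 prime_gt1 ?dp_prime.
have qp : 0 < q * p.-1 by rewrite muln_gt0 ltnW.
apply/trivgPn; exists (dick d (q * p.-1)).
  by rewrite inE dval_dick modn_small // NE ltn_Pmulr.
rewrite dval_eq1 dval_dick /dvdn modn_mod modn_small -?lt0n //.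
by rewrite NE ltn_Pmulr.
Qed.

(** Conjugation by [dick d 1] multiplies exponents in the residual by p, so the commutator
    multiplies them by p - 1, a unit modulo m. *)
Lemma dickson_residual_comm : dickson_residual \subset [~: dickson_residual, [set: T]].
Proof.
have p1 : 0 < p.-1 by rewrite -subn1 subn_gt0 prime_gt1 ?dp_prime.
have cop : coprime p.-1 m.
  by apply: coprime_dickson_sum; rewrite ?dp_prime ?dq_prime ?dq_odd ?dq_dvd.
have /coprimeP/(_ cop)[[u v] /= uv] := p1.
apply/subsetP=> r; rewrite inE => /dvdnP[j rE].
have eu : u * p.-1 = 1 + v * m by rewrite -uv subnK // ltnW // -subn_gt0 uv.
(* By Bezout, u inverts p - 1 modulo m, so p - 1 times the exponent of s is that of r modulo N. *)
pose s := dick d (q * p.-1 * (u * j)); pose g := dick d 1.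
have dN : q * p.-1 %| N by rewrite NE dvdn_mulr.
have Rs : s \in dickson_residual by rewrite inE dval_dick /dvdn modn_dvdm // modnMr.
have grs : (g * s = r * s * g)%g.
  have dr (x : T) : x \in dickson_residual -> q %| dval x.
    by rewrite inE; apply: dvdn_trans; rewrite dvdn_mulr.
  have Rr : r \in dickson_residual by rewrite inE rE dvdn_mull.
  have Rrs : (r * s)%g \in dickson_residual by rewrite (@groupM _ dickson_residual_group).
  apply: dval_inj; rewrite dvalM dvalM_ker ?dr // -[RHS]modnDml dvalM_ker ?dr // modnDml.
  have -> : dval g = 1 by rewrite dval_dick modn_small // dickson_order_gt1.
  rewrite expn1 addnC; apply/eqP; rewrite eqn_modDr; apply/eqP.
  rewrite -modnMmr -[RHS]modnDmr dval_dick modn_mod modnMmr modnDmr.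
  rewrite -{1}(prednK (prime_gt0 (dp_prime d))) mulSn addnC; apply/eqP; rewrite eqn_modDr.
  have -> : p.-1 * (q * p.-1 * (u * j)) = q * p.-1 * j * (u * p.-1).
    by move: p.-1 => p'; lia.
  rewrite eu rE NE.
  have -> : q * p.-1 * j * (1 + v * m) = v * j * (q * p.-1 * m) + j * (q * p.-1).
    by move: p.-1 => p'; lia.
  by rewrite modnMDl.
have -> : r = [~ g^-1, s^-1]%g.
  by rewrite /commg /conjg !invgK !mulgA grs mulgK mulgK.
rewrite commGC; apply: mem_commg; first by rewrite inE.
exact: (@groupVr _ dickson_residual_group).
Qed.

End DicksonSubgroups.

(** * The trace form and the action on the field *)

Section AbsoluteTrace.

Variables (F : finFieldType) (p q : nat).
Hypotheses (pr_p : prime p) (charF : p \in [pchar F]) (q_gt0 : (0 < q)%N).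
Hypothesis oF : #|F| = (p ^ q)%N.

Variable iota : {rmorphism 'F_p -> F}.

Let p_pow i : [pchar F].-nat (p ^ i)%N.
Proof. by rewrite pnatX (eq_pnat _ (pcharf_eq charF)) pnat_id. Qed.

Lemma exprDp i (x y : F) : (x + y) ^+ (p ^ i) = x ^+ (p ^ i) + y ^+ (p ^ i).
Proof. exact: exprDn_pchar (p_pow i). Qed.

Lemma iotaX c i : iota c ^+ (p ^ i) = iota c.
Proof.
rewrite -rmorphXn /=; congr (iota _).
have cp : c ^+ p = c by rewrite -[RHS]expf_card card_Fp.
by elim: i => [|i IHi]; rewrite ?expr1 // expnS exprM cp.
Qed.

(** X^p - X is the product of the X - c with c in F_p, so its roots in F are values of [iota]. The
    sigma type allows the trace to be extracted as an element of F_p. *)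
Lemma iota_fixP (x : F) : x ^+ p = x -> {c | iota c == x}.
Proof.
move=> xp; apply: sigW.
have : root (map_poly iota ('X^#|'F_p| - 'X)) x.
  by rewrite card_Fp // rmorphB rmorphXn /= map_polyX rootE !hornerE xp subrr.
rewrite finField_genPoly rmorph_prod /=.
rewrite (eq_bigr (fun c => 'X - (iota c)%:P)); last first.
  by move=> c _; rewrite rmorphB /= map_polyX map_polyC.
rewrite /root horner_prod prodf_seq_eq0 => /hasP[c _ /=].
by rewrite hornerXsubC subr_eq0 eq_sym; exists c.
Qed.

Let Tr (x : F) := \sum_(i < q) x ^+ (p ^ i).

Let TrX x : Tr (x ^+ p) = Tr x.
Proof.
have -> : Tr (x ^+ p) = \sum_(i < q) x ^+ (p ^ i.+1).
  by apply: eq_bigr => i _; rewrite -exprM -expnS.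
(* Frobenius shifts the sum by one index, and x^(p^q) = x closes the cycle. *)
apply: (addrI (x ^+ (p ^ 0))); rewrite -(big_ord_recl q (fun i => x ^+ (p ^ i))).
by rewrite big_ord_recr /= -oF expf_card expn0 expr1 addrC.
Qed.

Let Tr_fixed x : Tr x ^+ p = Tr x.
Proof.
rewrite -[RHS]TrX /Tr; elim/big_rec2: _ => [|i y1 y2 _ IH].
  by rewrite expr0n; case: (p) (prime_gt0 pr_p).
by rewrite -[(_ + y2) ^+ p]/(_ ^+ (p ^ 1)) exprDp expn1 IH -!exprM mulnC.
Qed.

Definition absolute_trace x : 'F_p := sval (iota_fixP (Tr_fixed x)).

Lemma absolute_traceE x : iota (absolute_trace x) = \sum_(i < q) x ^+ (p ^ i).
Proof. exact/eqP/(svalP (iota_fixP (Tr_fixed x))). Qed.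

Lemma absolute_traceD : {morph absolute_trace : x y / x + y}.
Proof.
move=> x y; apply: (fmorph_inj iota); rewrite rmorphD /= !absolute_traceE.
by rewrite -big_split; apply: eq_bigr => i _; rewrite /= exprDp.
Qed.

Lemma absolute_traceX i x : absolute_trace (x ^+ (p ^ i)) = absolute_trace x.
Proof.
apply: (fmorph_inj iota); rewrite !absolute_traceE.
by elim: i => // i IHi; rewrite expnSr exprM -[LHS]/(Tr _) TrX.
Qed.

Lemma absolute_traceZ c x : absolute_trace (iota c * x) = c * absolute_trace x.
Proof.
apply: (fmorph_inj iota); rewrite rmorphM /= !absolute_traceE mulr_sumr.
by apply: eq_bigr => i _; rewrite exprMn iotaX.
Qed.

(** The trace polynomial has degree p^(q - 1), too small to vanish at all p^q elements of F. *)
Lemma absolute_trace_neq0 : exists x, absolute_trace x != 0.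
Proof.
pose T : {poly F} := \sum_(i < q) 'X^(p ^ i).
have sT : size T = (p ^ q.-1).+1.
  have -> : T = \sum_(i < q.-1.+1) 'X^(p ^ i) by rewrite /T prednK.
  rewrite big_ord_recr /= addrC size_polyDl size_polyXn //.
  apply: leq_ltn_trans (size_sum _ _ _) _; rewrite ltnS.
  apply/bigmax_leqP=> i _; rewrite size_polyXn ltn_exp2l ?prime_gt1 //.
have nzT : T != 0 by rewrite -size_poly_eq0 sT.
have [x nzx|T0] := pickP (fun x => absolute_trace x != 0); first by exists x.
have : (size (enum F) < size T)%N.
  apply: max_poly_roots nzT _ (enum_uniq _); apply/allP=> x _.
  rewrite /root horner_sum (eq_bigr (fun i : 'I_q => x ^+ (p ^ i))); last first.
    by move=> i _; rewrite hornerXn.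
  by rewrite -absolute_traceE (eqP (negbFE (T0 x))) rmorph0.
rewrite sT -cardE oF ltnS leqNgt ltn_exp2l ?prime_gt1 //.
by rewrite prednK ?leqnn.
Qed.

Lemma exists_primitive_root : exists w : F, (p ^ q).-1.-primitive_root w.
Proof.
pose rs := [seq x <- enum F | x != 0]; have N_gt0 : (0 < (p ^ q).-1)%N.
  by rewrite -subn1 subn_gt0 -(exp1n q) ltn_exp2r ?prime_gt1.
suff /hasP[w _ prim_w] : has (p ^ q).-1.-primitive_root rs by exists w.
apply: has_prim_root; rewrite ?filter_uniq ?enum_uniq //.
  apply/allP=> x; rewrite mem_filter => /andP[x0 _].
  apply/unity_rootP; apply: (mulfI x0).
  by rewrite -exprS prednK ?expn_gt0 ?prime_gt0 // -oF expf_card mulr1.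
  by rewrite -enumT enum_uniq.
have Urs : uniq rs by rewrite filter_uniq // enum_uniq.
rewrite -oF -(cardC1 (0 : F)) cardE uniq_leq_size ?enum_uniq // => x.
by rewrite mem_enum inE => x0; rewrite /rs mem_filter x0 mem_enum.
Qed.

End AbsoluteTrace.

Section DicksonHeisenberg.

Variables (d : dickson_pair) (m : nat) (F : finFieldType) (w : F).
Local Notation p := (dp d).
Local Notation q := (dq d).
Local Notation N := (dickson_order d).
Hypotheses (charF : p \in [pchar F]) (oF : #|F| = (p ^ q)%N) (prim_w : N.-primitive_root w).
Variable iota : {rmorphism 'F_p -> F}.

Let pr_p := dp_prime d.
Let pr_q := dq_prime d.
Let q_gt0 : (0 < q)%N := prime_gt0 pr_q.
Let N_gt0 : (0 < N)%N := ltnW (dickson_order_gt1 d).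

Lemma exp_w_mod i j : i = j %[mod N] -> w ^+ i = w ^+ j.
Proof. by move=> ij; apply/eqP; rewrite (eq_prim_root_expr prim_w) ij. Qed.

Lemma exprp_mod_q (x : F) a b : a = b %[mod q] -> x ^+ (p ^ a) = x ^+ (p ^ b).
Proof.
move=> ab; have [->|x0] := eqVneq x 0.
  by rewrite !expr0n !expn_eq0 !(gtn_eqF (prime_gt0 pr_p)).
have xN : x ^+ N = 1.
  apply: (mulfI x0); rewrite -exprS prednK ?expn_gt0 ?prime_gt0 //.
  by rewrite -oF expf_card mulr1.
by rewrite -(expr_mod _ xN) (dickson_pexp ab) expr_mod.
Qed.

(** e = 1 is the near-field action used on X; another value of e gives the compatible action on
    Y. *)
Definition semilinear_fun e (k : dickson d) (x : F) := w ^+ (e * dval k) * x ^+ (p ^ dval k).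

Lemma semilinear_funD e k : {morph semilinear_fun e k : x y / x + y}.
Proof. by move=> x y; rewrite /semilinear_fun (exprDp pr_p charF) mulrDr. Qed.

Lemma semilinear_fun1 e x : semilinear_fun e 1%g x = x.
Proof. by rewrite /semilinear_fun dval1 muln0 mul1r. Qed.

Lemma semilinear_funM e k l x :
  semilinear_fun e (k * l)%g x = semilinear_fun e k (semilinear_fun e l x).
Proof.
rewrite /semilinear_fun (exprp_mod_q _ (dvalM_q k l)).
rewrite (@exp_w_mod _ (e * (dval k + p ^ dval k * dval l))); last first.
  by rewrite -modnMmr dvalM modnMmr.
rewrite exprMn -!exprM mulrA -exprD; congr (w ^+ _ * x ^+ _).
  by rewrite mulnDr [(p ^ _ * _)%N]mulnC mulnA.
by rewrite addnC expnD.
Qed.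

Definition semilinear_action e :=
  AdditiveAction (@semilinear_funD e) (@semilinear_fun1 e) (@semilinear_funM e).

(** For x = w^j a fixed point means e k + p^k j = j modulo N. Modulo q this gives q | k, so p^k = 1
    modulo N, and then N | e k forces N | k. *)
Lemma semilinear_fixfree e k x :
  coprime e N -> k != 1%g -> semilinear_action e k x = x -> x = 0.
Proof.
move=> cop k1; apply: contra_eq => x0 /=; apply: contra k1.
have /(prim_rootP prim_w)[j ->] : x ^+ N = 1.
  apply: (mulfI x0); rewrite -exprS prednK ?expn_gt0 ?prime_gt0 //.
  by rewrite -oF expf_card mulr1.
rewrite /semilinear_fun -exprM -exprD (eq_prim_root_expr prim_w) => E.
have dq : (q %| dval k)%N.
  have copq : coprime q e by rewrite coprime_sym (coprime_dvdr (dvdn_q_order d)).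
  rewrite -(Gauss_dvdr _ copq) /dvdn; move/eqP: E => /(congr1 (modn^~ q)).
  rewrite !modn_dvdm ?dvdn_q_order // -modnDmr -modnMmr pexp_mod_q modnMmr muln1 modnDmr.
  by move/eqP; rewrite -{2}[j : nat]add0n eqn_modDr mod0n.
move: E; rewrite -modnDmr -modnMmr (dickson_pexp (b := 0)) ?mod0n; last exact/eqP.
rewrite modnMmr muln1 modnDmr -{2}[j : nat]add0n eqn_modDr mod0n.
by rewrite dval_eq1 -(Gauss_dvdr _ (_ : coprime N e)) // coprime_sym.
Qed.

End DicksonHeisenberg.

HB.instance Definition _ (U V : finZmodType) := Finite.on (U * V)%type.

(** * The Heisenberg group of the trace form with Dickson operators *)

Section Construction.

Variables (d : dickson_pair) (m : nat) (F : finFieldType) (w : F).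
Local Notation p := (dp d).
Local Notation q := (dq d).
Local Notation N := (dickson_order d).
Hypotheses (charF : p \in [pchar F]) (oF : #|F| = (p ^ q)%N) (prim_w : N.-primitive_root w).
Variable iota : {rmorphism 'F_p -> F}.

Let pr_p := dp_prime d.
Let pr_q := dq_prime d.
Let q_gt0 : (0 < q)%N := prime_gt0 pr_q.
Let Nq := (N %/ q)%N.

Let NqE : N = (q * Nq)%N.
Proof. by rewrite mulnC divnK // dvdn_q_order. Qed.

(** q divides both p - 1 and (p^q - 1) / (p - 1), so q^2 divides N. *)
Let q_dvd_Nq : (q %| Nq)%N.
Proof.
rewrite -(dvdn_pmul2l q_gt0) -NqE /dickson_order dickson_factor dvdn_mul ?dq_dvd //.
by rewrite dvdn_dickson_sum ?dp_prime ?dq_prime ?dq_odd ?dq_dvd.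
Qed.

Let Nq_gt0 : (0 < Nq)%N.
Proof. by have := ltnW (dickson_order_gt1 d); rewrite NqE muln_gt0 => /andP[]. Qed.

(** w^Nq has order q, which divides p - 1, so Frobenius fixes it. *)
Let exists_zeta : exists zeta : 'F_p, iota zeta == w ^+ Nq.
Proof.
have [|zeta Ez] := @iota_fixP F p pr_p iota (w ^+ Nq); last by exists zeta.
have [t p1] := dvdnP (dq_dvd d).
rewrite -exprM; apply: (exp_w_mod prim_w).
rewrite -(prednK (prime_gt0 pr_p)) p1 mulnS addnC mulnCA [(Nq * q)%N]mulnC -NqE.
by rewrite modnMDl.
Qed.

Let zeta : 'F_p := xchoose exists_zeta.
Let iota_zeta : iota zeta = w ^+ Nq := eqP (xchooseP exists_zeta).

Let prim_zeta : q.-primitive_root zeta.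
Proof.
rewrite -(fmorph_primitive_root iota) iota_zeta.
by apply: (dvdn_prim_root prim_w); exact: dvdn_q_order.
Qed.

(* Acting with exponent e on the second copy of F multiplies the trace form by
   w ^+ (e + 1) = iota zeta. *)
Let e : nat := Nq.-1.

(** e = Nq - 1 is coprime to Nq, hence also to its divisor q, and N = q Nq. *)
Let cop_e : coprime e N.
Proof.
have cop1 : coprime e Nq by rewrite -[X in coprime _ X](prednK Nq_gt0) coprimenS.
by rewrite NqE coprimeMr cop1 andbT (coprime_dvdr q_dvd_Nq).
Qed.

Let zeta_dvalM (k l : dickson d) :
  zeta ^+ dval (k * l)%g = zeta ^+ dval k * zeta ^+ dval l.
Proof.
by rewrite -exprD; apply/eqP; rewrite (eq_prim_root_expr prim_zeta) dvalM_q.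
Qed.

Let W := 'rV['F_p]_m.

(** The whole twist on W is put on the Y side, so that both summands of the pairing are multiplied
    by the same scalar [zeta ^+ dval k], which is 1 for k in the kernel. *)
Definition dX_fun (k : dickson d) (x : F * W) : F * W :=
  (semilinear_action charF oF prim_w 1 k x.1, x.2).
Definition dY_fun (k : dickson d) (y : F * W) : F * W :=
  (semilinear_action charF oF prim_w e k y.1, zeta ^+ dval k *: y.2).
Definition dZ_fun (k : dickson d) (z : 'F_p) : 'F_p := zeta ^+ dval k * z.

Let dXD k : {morph dX_fun k : u v / u + v}.
Proof. by move=> u v; rewrite /dX_fun aactD. Qed.
Let dX1 v : dX_fun 1%g v = v.
Proof. by rewrite /dX_fun aact1; case: v. Qed.
Let dXM k l v : dX_fun (k * l)%g v = dX_fun k (dX_fun l v).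
Proof. by rewrite /dX_fun aactM. Qed.
Let dYD k : {morph dY_fun k : u v / u + v}.
Proof. by move=> u v; rewrite /dY_fun aactD scalerDr. Qed.
Let dY1 v : dY_fun 1%g v = v.
Proof. by rewrite /dY_fun aact1 dval1 expr0 scale1r; case: v. Qed.
Let dYM k l v : dY_fun (k * l)%g v = dY_fun k (dY_fun l v).
Proof. by rewrite /dY_fun aactM zeta_dvalM scalerA. Qed.
Let dZD k : {morph dZ_fun k : u v / u + v}.
Proof. by move=> u v; rewrite /dZ_fun mulrDr. Qed.
Let dZ1 v : dZ_fun 1%g v = v.
Proof. by rewrite /dZ_fun dval1 mul1r. Qed.
Let dZM k l v : dZ_fun (k * l)%g v = dZ_fun k (dZ_fun l v).
Proof. by rewrite /dZ_fun zeta_dvalM mulrA. Qed.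

Let tau := absolute_trace pr_p charF oF iota.

Let tauD : {morph tau : a b / a + b} := absolute_traceD pr_p charF oF iota.

Definition dpairing (x y : F * W) : 'F_p := tau (x.1 * y.1) + (x.2 *m y.2^T) 0 0.

Let dpairingDl y : {morph dpairing^~ y : x x' / x + x'}.
Proof.
move=> x x'; rewrite /dpairing /= mulrDl mulmxDl mxE tauD.
by rewrite addrACA.
Qed.

Let dpairingDr x : {morph dpairing x : y y' / y + y'}.
Proof.
move=> y y'; rewrite /dpairing /= mulrDr linearD mulmxDr mxE tauD.
by rewrite addrACA.
Qed.

(** On F the product of the images is zeta^k (x y)^(p^k); the trace is F_p-linear and
    Frobenius-invariant. *)
Let dpairing_act k x y : dpairing (dX_fun k x) (dY_fun k y) = dZ_fun k (dpairing x y).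
Proof.
rewrite /dpairing /dX_fun /dY_fun /dZ_fun /= mulrDr; congr (_ + _); last first.
  by rewrite linearZ -scalemxAr mxE.
rewrite /semilinear_fun mulrACA -exprD -mulnDl add1n (prednK Nq_gt0) -exprMn.
by rewrite exprM -iota_zeta -rmorphXn /tau absolute_traceZ absolute_traceX.
Qed.

Definition dickson_heisenberg : heisenberg_data :=
  @HeisenbergData (dickson d) (F * W)%type (F * W)%type 'F_p dpairing
    (AdditiveAction dXD dX1 dXM) (AdditiveAction dYD dY1 dYM) (AdditiveAction dZD dZ1 dZM)
    dpairingDl dpairingDr dpairing_act.

(** The summand F, used for both [A] and [E] of the chain. *)
Let A : {set F * W} := [set x | x.2 == 0].

Let A_closed : act_closed (aX dickson_heisenberg) [set: dickson d] A.
Proof.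
split=> [|u v|k u _]; rewrite !inE //=; first by move=> /eqP-> /eqP->; rewrite addr0.
Qed.

Let E_closed : act_closed (aY dickson_heisenberg) [set: dickson d] A.
Proof.
split=> [|u v|k u _]; rewrite !inE //=; first by move=> /eqP-> /eqP->; rewrite addr0.
by move=> /eqP->; rewrite scaler0.
Qed.

Let AN x : x \in A -> - x \in A.
Proof. by rewrite !inE /= oppr_eq0. Qed.

Let row_pairing0 (r : W) : (forall s : W, (r *m s^T) 0 0 = 0) -> r = 0.
Proof.
move=> r0; apply/rowP=> j; rewrite mxE -(r0 (delta_mx 0 j)) trmx_delta -colE.
by rewrite mxE.
Qed.

Let tau0 : tau 0 = 0.
Proof. by apply: (addrI (tau 0)); rewrite -tauD !addr0. Qed.

Let trace_pairing0 (v : F) : (forall b, tau (v * b) = 0) -> v = 0.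
Proof.
have [t nzt] := absolute_trace_neq0 pr_p charF q_gt0 oF iota.
(* If v is nonzero, b = v^-1 t would have tau (v b) = tau t, which is nonzero. *)
move=> v0; apply: contraNeq nzt => nzv; rewrite -/tau.
by rewrite -[t](mulKf nzv) mulrA [v^-1 * v]mulrC -mulrA v0.
Qed.

Let nondeg_l (x : F * W) : (forall y, dpairing x y = 0) -> x = 0.
Proof.
case: x => v r x0; congr (_, _).
  apply: trace_pairing0 => b; have := x0 (b, 0).
  by rewrite /dpairing /= trmx0 mulmx0 mxE addr0.
apply: row_pairing0 => s; have := x0 (0, s).
by rewrite /dpairing /= mulr0 tau0 add0r.
Qed.

Let nondeg_r (y : F * W) : (forall x, dpairing x y = 0) -> y = 0.
Proof.
move=> y0; apply: nondeg_l => x; rewrite -(y0 x) /dpairing mulrC; congr (_ + _).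
by rewrite -[in LHS](trmxK y.2) -trmx_mul mxE.
Qed.

Lemma dickson_heisenberg_chain (G := [set: heisenberg dickson_heisenberg]%G) :
  [/\ solvable G, derived_length_eq G 4, fitting_height_eq G 3 &
  cd G =i [seq (k%:R : algC) | k <- [:: 1%N; q; N; p ^ (q + m) * q]%N]].
Proof.
have cX : #|{: F * W}| = (p ^ (q + m))%N.
  by rewrite card_prod oF card_mx card_Fp // mul1n expnD.
have oD : #|hG dickson_heisenberg| = N.
  exact: etrans (card_ord _) (prednK (ltnW (dickson_order_gt1 d))).
have := @heisenberg_chain dickson_heisenberg ('ker (@dresidue d))%G
  (dickson_residual_group d) A A p q (q + m).
rewrite oD; apply=> //.
- by rewrite card_Fp.
- exact: dkernel_normal.
- exact: dkernel_index.
- exact: dkernel_abelian.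
- exact: dickson_residual_nontrivial.
- exact: dickson_residual_comm.
(* [zeta] has order q, so [zeta ^+ dval k] is 1 exactly on the kernel: there Z is fixed pointwise,
   and elsewhere only 0 is fixed. *)
- move=> k z; rewrite in_dkernel (prim_order_dvd prim_zeta) => /eqP Ek.
  by rewrite /= /dZ_fun Ek mul1r.
- move=> k z; rewrite in_dkernel (prim_order_dvd prim_zeta) => nk.
  rewrite /= /dZ_fun => Ez; apply: contraNeq nk => nz.
  by apply/eqP/(mulIf nz); rewrite Ez mul1r.
- by move=> k x _; rewrite inE /= subrr.
- move=> k x; rewrite in_dkernel (prim_order_dvd prim_zeta) => /eqP Ek.
  by rewrite inE /= Ek scale1r subrr.
- move=> k [v r] k1; rewrite inE => /eqP /= -> /(congr1 fst) /= Ev.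
  by rewrite (semilinear_fixfree (coprime1n _) k1 Ev).
- move=> k [v r] k1; rewrite inE => /eqP /= -> /(congr1 fst) /= Ev.
  by rewrite (semilinear_fixfree cop_e k1 Ev).
have [t nzt] := absolute_trace_neq0 pr_p charF q_gt0 oF iota.
exists (t, 0); rewrite ?inE //; exists (1, 0); rewrite ?inE //.
by rewrite /= /dpairing /= mulr1 mul0mx mxE addr0.
Qed.

End Construction.

Local Close Scope ring_scope.
Local Close Scope group_scope.

Theorem theorem3p5 (p q n : nat) :
  prime p -> prime q -> odd q -> q %| p.-1 -> q < n ->
  exists (gT : finGroupType) (G : {group gT}),
    [/\ solvable G, derived_length_eq G 4, fitting_height_eq G 3 &
        cd G =i [seq ((d%:R)%R : algC) | d <- [:: 1%N; q; ((p ^ q).-1)`_q^' * (p.-1)`_q * q;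
                                              p ^ n * q]]].
Proof.
move=> pr_p pr_q q_odd q_dv lt_qn.
pose d := DicksonPair pr_p pr_q q_odd q_dv.
have q_gt0 := prime_gt0 pr_q.
have [F charF oF] := pPrimePowerField pr_p q_gt0.
have [w prim_w] := exists_primitive_root pr_p q_gt0 oF.
pose iota : {rmorphism 'F_p -> F} :=
  (in_alg (pPrimeCharType charF) : {rmorphism 'F_p -> pPrimeCharType charF}).
(* Taking W of dimension n - q gives X and Y order p^n. *)
have := @dickson_heisenberg_chain d (n - q) F w charF oF prim_w iota.
rewrite subnKC ?(ltnW lt_qn) // => main.
by do 2!eexists; rewrite partn_dickson //; apply: main.
Qed.
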